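(* Let $k$ be a unital commutative ring, let $r$ and $s$ be non-negative integers, and let $\delta\in k$ be invertible. Then there exist isomorphisms of graded $k$-modules \[\operatorname{Tor}_{\star}^{\mathcal{B}_{r,s}(\delta)}(\mathbf{1},\mathbf{1})\cong H_{\star}(\Sigma_r\times\Sigma_s,\mathbf{1})\quad\text{and}\quad \operatorname{Ext}^{\star}_{\mathcal{B}_{r,s}(\delta)}(\mathbf{1},\mathbf{1})\cong H^{\star}(\Sigma_r\times\Sigma_s,\mathbf{1}).\]
   Context: Let $N=r+s$. A Brauer $N$-diagram is a graph on $2N$ vertices $1,\dots,N$ (left column, top to bottom) and $\bar1,\dots,\bar N$ (right column, top to bottom) in which every vertex lies on exactly one edge and each edge joins two distinct vertices; diagrams are determined by which pairs of vertices are joined. An edge joining the two columns is propagating, an edge joining two vertices of the same column is non-propagating. A walled Brauer $(r+s)$-diagram is a Brauer $N$-diagram such that every propagating edge joins one of the first $r$ left vertices to one of the first $r$ right vertices, or one of the last $s$ left vertices to one of the last $s$ right vertices, and every non-propagating edge joins one of the first $r$ vertices of its column to one of the last $s$ vertices of that column. The walled Brauer algebra $\mathcal{B}_{r,s}(\delta)$ is the free $k$-module on walled Brauer $(r+s)$-diagrams with product of diagrams $d_1d_2$ given as follows: identify the right column of $d_1$ with the left column of $d_2$ (the middle column); let $\alpha$ be the number of closed loops lying entirely in the middle column; let $d_3$ be the diagram on the outer columns in which two vertices are joined iff they are joined by a path; then $d_1d_2=\delta^{\alpha}d_3$. The identity is the diagram with horizontal edges $\{i,\bar i\}$. The augmentation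 $\tau:\mathcal{B}_{r,s}(\delta)\to k$ sends diagrams with $N$ propagating edges to $1$ and all other diagrams to $0$; $\mathbf{1}$ denotes $k$ with the algebra acting via $\tau$. $H_\star(G,\mathbf{1})$, $H^\star(G,\mathbf{1})$ denote group (co)homology with trivial coefficients $k$. *)

(* Defs.v *)
From mathcomp Require Import all_boot all_order all_algebra all_fingroup.
Set Implicit Arguments. Unset Strict Implicit. Unset Printing Implicit Defensive.
Import GRing.Theory.
Local Open Scope ring_scope.

(* Isomorphism of subquotients of free k-modules {ffun I -> k}.        *)
(* Z/B ~= Z'/B' (B <= Z, B' <= Z' submodules) is encoded by a map f   *)
(* which is k-linear modulo B', maps Z into Z', is surjective onto     *)
(* Z' modulo B', and whose "kernel modulo B'" on Z is exactly B.       *)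
(* Such f exist iff the induced k-module isomorphism Z/B ~= Z'/B'      *)
(* exists (choose representatives of a given isomorphism).             *)
Section Subquot.
Variable k : comPzRingType.

Definition fscale (I : finType) (a : k) (z : {ffun I -> k}) : {ffun I -> k} :=
  [ffun x => a * z x].

Definition subquot_iso (I I' : finType)
  (Z B : {ffun I -> k} -> Prop) (Z' B' : {ffun I' -> k} -> Prop) : Prop :=
  exists f : {ffun I -> k} -> {ffun I' -> k},
    [/\ (forall z, Z z -> Z' (f z)),
        (forall z z', Z z -> Z z' -> B' (f (z + z') - (f z + f z'))),
        (forall a z, Z z -> B' (f (fscale a z) - fscale a (f z))),
        (forall z', Z' z' -> exists2 z, Z z & B' (z' - f z)) &
        (forall z, Z z -> (B' (f z) <-> B z))].
End Subquot.

(* Bar complex of an augmented k-algebra A which is free over k with   *)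
(* finite basis D:  product  d1 d2 = \sum_d mult d1 d2 d *: d,          *)
(* augmentation  eps : D -> k.                                         *)
(* Tor^A_n(1,1) is the homology of  1 (x)_A Bar(A) (x)_A 1, whose       *)
(* degree-n term is A^{(x)n}, free on D^n; Ext^n_A(1,1) is the          *)
(* cohomology of Hom_A(Bar(A) (x)_A 1, 1) = Hom_k(A^{(x)n}, k), also    *)
(* identified with functions D^n -> k.                                 *)
Section Bar.
Variables (k : comPzRingType) (D : finType).
Variables (mult : D -> D -> D -> k) (eps : D -> k).

Definition tup n := {ffun 'I_n -> D}.
Definition chains n := {ffun tup n -> k}.

Definition at_ n (a : tup n.+1) (m : nat) : D := a (inord m).
Definition tail_ n (a : tup n.+1) : tup n := [ffun j : 'I_n => at_ a j.+1].
Definition init_ n (a : tup n.+1) : tup n := [ffun j : 'I_n => at_ a j].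
Definition merge_ n (a : tup n.+1) (i : 'I_n) (d : D) : tup n :=
  [ffun j : 'I_n => if (j < i)%N then at_ a j
                    else if j == i then d else at_ a j.+1].

(* coefficient of basis element b in d(a), where
   d(a_0 (x) ... (x) a_n) = eps(a_0) a_1 (x)..(x) a_n
     + \sum_{i<n} (-1)^(i+1) a_0 (x)..(x) a_i a_{i+1} (x)..(x) a_n
     + (-1)^(n+1) a_0 (x)..(x) a_{n-1} eps(a_n) *)
Definition bd_coef n (a : tup n.+1) (b : tup n) : k :=
  eps (at_ a 0) * (b == tail_ a)%:R
  + \sum_(i < n) (-1) ^+ i.+1 *
       (\sum_(d : D) mult (at_ a i) (at_ a i.+1) d * (b == merge_ a i d)%:R)
  + (-1) ^+ n.+1 * eps (at_ a n) * (b == init_ a)%:R.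

Definition bd n (f : chains n.+1) : chains n :=
  [ffun b => \sum_(a : tup n.+1) f a * bd_coef a b].
Definition cobd n (phi : chains n) : chains n.+1 :=
  [ffun a => \sum_(b : tup n) bd_coef a b * phi b].

Definition cycles n : chains n -> Prop :=
  match n with 0 => fun _ => True | m.+1 => fun f => bd f = 0 end.
Definition boundaries n (f : chains n) : Prop := exists g : chains n.+1, bd g = f.
Definition cocycles n (phi : chains n) : Prop := cobd phi = 0.
Definition coboundaries n : chains n -> Prop :=
  match n with 0 => fun phi => phi = 0
  | m.+1 => fun phi => exists psi : chains m, cobd psi = phi end.
End Bar.

Definition Tor_iso (k : comPzRingType) (D D' : finType)
  (m : D -> D -> D -> k) (e : D -> k) (m' : D' -> D' -> D' -> k) (e' : D' -> k)
  (n : nat) : Prop :=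
  subquot_iso (@cycles k D m e n) (@boundaries k D m e n)
              (@cycles k D' m' e' n) (@boundaries k D' m' e' n).
Definition Ext_iso (k : comPzRingType) (D D' : finType)
  (m : D -> D -> D -> k) (e : D -> k) (m' : D' -> D' -> D' -> k) (e' : D' -> k)
  (n : nat) : Prop :=
  subquot_iso (@cocycles k D m e n) (@coboundaries k D m e n)
              (@cocycles k D' m' e' n) (@coboundaries k D' m' e' n).

(* Walled Brauer diagrams.  Vertex (false, i) = left vertex i+1,        *)
(* (true, i) = right vertex \bar{i+1}; i : 'I_(r+s).                   *)
(* A diagram is a fixed-point-free involution of the vertices.         *)
Section WalledBrauer.
Variables r s : nat.
Definition Nv := (r + s)%N.
Definition vert := (bool * 'I_Nv)%type.

Definition walled_edge (x y : vert) : bool :=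
  if x.1 != y.1 then (* propagating *) ((x.2 < r)%N == (y.2 < r)%N)
  else (* non-propagating *) ((x.2 < r)%N != (y.2 < r)%N).

Definition is_wb (p : {ffun vert -> vert}) : bool :=
  [forall x, [&& p (p x) == x, p x != x & walled_edge x (p x)]].

Definition wbdiag := {p : {ffun vert -> vert} | is_wb p}.

(* Composite graph: W = 'I_3 * 'I_Nv, column 0 = left of d1,
   column 1 = middle, column 2 = right of d2. *)
Definition wvert := ('I_3 * 'I_Nv)%type.
Definition col_ (x : wvert) : nat := x.1.
Definition as1 (x : wvert) : vert := (col_ x == 1%N, x.2).
Definition as2 (x : wvert) : vert := (col_ x == 2%N, x.2).
Definition comp_edge (d1 d2 : wbdiag) : rel wvert := fun x y =>
  [&& (col_ x <= 1)%N, (col_ y <= 1)%N & val d1 (as1 x) == as1 y]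
  || [&& (1 <= col_ x)%N, (1 <= col_ y)%N & val d2 (as2 x) == as2 y].
Definition outer (u : vert) : wvert := (inord (if u.1 then 2 else 0), u.2).

Definition nloops (d1 d2 : wbdiag) : nat :=
  #|[pred x : wvert | [&& col_ x == 1%N,
        [forall y, connect (comp_edge d1 d2) x y ==> (col_ y == 1%N)]
      & fingraph.root (comp_edge d1 d2) x == x]]|.

Definition wb_mult (k : comPzRingType) (delta : k) (d1 d2 d3 : wbdiag) : k :=
  if [forall u : vert, forall v : vert,
        (val d3 u == v) == ((u != v) && connect (comp_edge d1 d2) (outer u) (outer v))]
  then delta ^+ nloops d1 d2 else 0.

Definition wb_eps (k : comPzRingType) (d : wbdiag) : k :=
  if [forall i : 'I_Nv, (val d (false, i)).1] then 1 else 0.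
End WalledBrauer.

Definition symprod r s := ({perm 'I_r} * {perm 'I_s})%type.
Definition grp_mult (k : comPzRingType) r s (g h x : symprod r s) : k :=
  if x == ((g.1 * h.1)%g, (g.2 * h.2)%g) then 1 else 0.
Definition grp_eps (k : comPzRingType) r s (g : symprod r s) : k := 1.

(* Main.v *)
(* Let I be the ideal of B = B_{r,s}(delta) spanned by the diagrams with a
   non-propagating edge, so that B/I is the group algebra of Sigma_r x Sigma_s,
   embedded in B by the permutation diagrams. The bar complex of B is therefore
   the direct sum of the bar complex of the group algebra and of the span K of
   the tuples containing a diagram of I, and K must be shown to be acyclic. Let
   the level of a diagram be its number of vertices on left non-propagating
   edges; it can only grow under products. If x is in I and e_x is the diagram
   with the left edges of x, their mirror images and horizontal edges elsewhere,
   then e_x x = delta^m x, and e_{xy} = e_x as long as xy has the same level as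
   x. Inserting delta^{-m} e_x in front of the first entry x of maximal level is
   a chain homotopy between the identity and a map which strictly increases the
   maximal level of a tuple or strictly decreases the position where it is first
   attained; that map is nilpotent, so K is acyclic.

   Associativity of the product of B, including the exponents of delta, comes
   from 2-colourings: the number of colourings of the middle column that are
   constant on edges, for given colours of the outer columns, is 2^loops or 0,
   and so it turns the product of diagrams into a product of matrices. *)
Require Import Defs.
From mathcomp Require Import all_boot all_order all_algebra all_fingroup.
From mathcomp Require Import ring zify.
Set Implicit Arguments. Unset Strict Implicit. Unset Printing Implicit Defensive.
Import GRing.Theory.
Local Open Scope ring_scope.

(** * The bar differential on functions of lists *)

Section ListCochains.
Variables (k : comPzRingType) (D : Type).
Variables (mul : D -> D -> D) (w : D -> D -> k) (eps : D -> k).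
Implicit Types (F G : seq D -> k) (s l : seq D).

(** The face that merges [x] into the next entry; if no entry follows, [x] is the last one and is
    removed by the augmentation. *)
Definition act x F s : k :=
  if s is y :: s' then w x y * F (mul x y :: s') else eps x * F [::].

(* The bar differential without its first face, dualised, on functions of lists
   of all lengths at once. The sign in the recursive call is the shift by one of
   the positions of the remaining faces. *)
Fixpoint rcob F s : k :=
  if s is x :: s' then - act x F s' - rcob (fun l => F (x :: l)) s' else 0.

Definition lcob F s : k := if s is x :: s' then eps x * F s' else 0.

Definition lscob F s : k := lcob F s + rcob F s.

Lemma act_sum (I : Type) (r : seq I) (c : I -> k) (f : I -> seq D -> k) x s :
  act x (fun l => \sum_(i <- r) c i * f i l) s = \sum_(i <- r) c i * act x (f i) s.
Proof.
by case: s => [|y s] /=; rewrite mulr_sumr; apply: eq_bigr => i _; ring.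
Qed.

Lemma rcob_sum (I : Type) (r : seq I) (c : I -> k) (f : I -> seq D -> k) s :
  rcob (fun l => \sum_(i <- r) c i * f i l) s = \sum_(i <- r) c i * rcob (f i) s.
Proof.
elim: s f => [|x s IH] f /=; first by rewrite big1 // => i _; rewrite mulr0.
rewrite act_sum (IH (fun i l => f i (x :: l))) -!sumrN -big_split /=.
by apply: eq_bigr => i _; ring.
Qed.

Lemma eq_act x F G s : (forall l, size l = size s -> F l = G l) -> act x F s = act x G s.
Proof. by case: s => [|y s] e /=; rewrite e. Qed.

(** The differential at [s] evaluates its argument only on lists one entry shorter, so agreement in
    a single degree is enough. *)
Lemma eq_rcob F G s :
  (forall l, (size l).+1 = size s -> F l = G l) -> rcob F s = rcob G s.
Proof.
elim: s F G => [|x s IH] F G e //=; congr (- _ - _).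
  by apply: eq_act => l sl; apply: e; rewrite /= sl.
by apply: IH => l sl; apply: e; rewrite /= -sl.
Qed.

Lemma eq_lscob F G s :
  (forall l, (size l).+1 = size s -> F l = G l) -> lscob F s = lscob G s.
Proof.
move=> e; rewrite /lscob (eq_rcob e); congr (_ + _).
by case: s e => //= x s e; rewrite e.
Qed.

Lemma rcob_lin a b F G s :
  rcob (fun l => a * F l + b * G l) s = a * rcob F s + b * rcob G s.
Proof.
have := rcob_sum [:: true; false] (fun i : bool => if i then a else b)
                 (fun i : bool => if i then F else G) s.
rewrite !big_cons big_nil addr0 => <-; apply: eq_rcob => l _.
by rewrite !big_cons big_nil addr0.
Qed.

Lemma rcobZ a F s : rcob (fun l => a * F l) s = a * rcob F s.
Proof.
rewrite -[RHS]addr0 -[0 in RHS](mul0r (rcob F s)) -rcob_lin.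
by apply: eq_rcob => l _; ring.
Qed.

Hypothesis mulA : associative mul.
Hypothesis wA : forall x y z, w x y * w (mul x y) z = w y z * w x (mul y z).
Hypothesis epsM : forall x y, eps x * eps y = w x y * eps (mul x y).

Lemma act_act x y F s : act y (act x F) s = w x y * act (mul x y) F s.
Proof.
case: s => [|z s] /=; first by rewrite mulrA [eps y * _]mulrC epsM; ring.
by rewrite [RHS]mulrA wA mulA; ring.
Qed.

(** Merging [x] into the first entry does not affect the later faces; the one face that touches the
    merged entry is covered by [act_act]. *)
Lemma act_rcob x F s : act x (rcob F) s = rcob (act x F) s.
Proof.
case: s => [|y s] /=; first by rewrite mulr0.
by rewrite act_act rcobZ; ring.
Qed.

(** Splitting off the first entry leaves [act x (rcob F)] and [rcob (act x F)] with opposite signs;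
    the remainder is the same identity for a shorter list. *)
Lemma rcob_rcob F s : rcob (rcob F) s = 0.
Proof.
elim: s F => [|x s IH] F //=.
have -> : rcob (fun l => - act x F l - rcob (fun l0 => F (x :: l0)) l) s
   = - rcob (act x F) s.
  transitivity (-1 * rcob (act x F) s + -1 * rcob (rcob (fun l => F (x :: l))) s).
    by rewrite -rcob_lin; apply: eq_rcob => l _; ring.
  by rewrite IH; ring.
by rewrite act_rcob; ring.
Qed.

Lemma lscob_lscob F s : lscob (lscob F) s = 0.
Proof.
rewrite /lscob.
have -> : rcob (fun l => lcob F l + rcob F l) s = rcob (lcob F) s.
  transitivity (1 * rcob (lcob F) s + 1 * rcob (rcob F) s).
    by rewrite -rcob_lin; apply: eq_rcob => l _; ring.
  by rewrite rcob_rcob; ring.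
case: s => [|x s] /=; first by ring.
rewrite rcobZ.
(* Merging the first two entries and dropping the product amounts to dropping both in turn, since
   [eps] is multiplicative. *)
have -> : act x (lcob F) s = eps x * lcob F s.
  by case: s => [|y s] //=; rewrite mulrA -epsM; ring.
by ring.
Qed.

(** * The contraction *)

(** Abstract form of the data of the contraction: [e x] is the element inserted in front of [x], and
    [eta x] inverts the coefficient that appears when the two are multiplied again. *)
Variables (lev : D -> nat) (e : D -> D) (eta : D -> k).
Hypothesis lev_mull : forall x y, (lev x <= lev (mul x y))%N.
Hypothesis lev_mulr : forall x y, (lev y <= lev (mul x y))%N.
Hypothesis eps_lev : forall x, (0 < lev x)%N -> eps x = 0.
Hypothesis lev_e : forall x, lev (e x) = lev x.
Hypothesis mul_e : forall x, (0 < lev x)%N -> mul (e x) x = x.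
Hypothesis eta_w : forall x, (0 < lev x)%N -> eta x * w (e x) x = 1.
Hypothesis e_mul : forall x y, lev (mul x y) = lev x -> e (mul x y) = e x.
Hypothesis eta_mul : forall x y, (0 < lev x)%N -> lev (mul x y) = lev x ->
  eta (mul x y) = eta x.

Section Level.
Variable t : nat.
Hypothesis t_gt0 : (0 < t)%N.

(* The sign (-1)^(m+1) of the insertion at position m makes the faces before
   that position cancel in [lscob (ins F) + ins (lscob F)]. *)
Fixpoint ins F s : k :=
  if s is x :: s' then
    if (t <= lev x)%N then - (eta x * F (e x :: x :: s'))
    else - ins (fun l => F (x :: l)) s'
  else 0.

Lemma ins_sum (I : Type) (r : seq I) (c : I -> k) (f : I -> seq D -> k) s :
  ins (fun l => \sum_(i <- r) c i * f i l) s = \sum_(i <- r) c i * ins (f i) s.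
Proof.
elim: s f => [|x s IH] f /=; first by rewrite big1 // => i _; rewrite mulr0.
case: ifP => _; last first.
  by rewrite (IH (fun i l => f i (x :: l))) -sumrN; apply: eq_bigr => i _; ring.
by rewrite mulr_sumr -sumrN; apply: eq_bigr => i _; ring.
Qed.

Lemma eq_ins F G s :
  (forall l, size l = (size s).+1 -> F l = G l) -> ins F s = ins G s.
Proof.
elim: s F G => [|x s IH] F G eFG //=; case: ifP => _; first by rewrite eFG.
by congr (- _); apply: IH => l sl; apply: eFG; rewrite /= sl.
Qed.

Lemma ins_lin a b F G s :
  ins (fun l => a * F l + b * G l) s = a * ins F s + b * ins G s.
Proof.
have := ins_sum [:: true; false] (fun i : bool => if i then a else b)
                 (fun i : bool => if i then F else G) s.
rewrite !big_cons big_nil addr0 => <-; apply: eq_ins => l _.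
by rewrite !big_cons big_nil addr0.
Qed.

Lemma insZ a F s : ins (fun l => a * F l) s = a * ins F s.
Proof.
rewrite -[RHS]addr0 -[0 in RHS](mul0r (ins F s)) -ins_lin.
by apply: eq_ins => l _; ring.
Qed.

Definition above s := has (fun x => (t < lev x)%N) s.
(* The filtration of the header: maximal level above [t], or first entry of
   level at least [t] before position [j]. *)
Definition good j s :=
  above s || has (fun x => (t <= lev x)%N) s && (find (fun x => (t <= lev x)%N) s < j)%N.

(** If the insertion is in front of the first entry, both terms contain the augmentation of an
    element of positive level; otherwise they differ by the sign of the shifted position. *)
Lemma ins_lcob F s : lcob (ins F) s + ins (lcob F) s = 0.
Proof.
case: s => [|x s] /=; first by rewrite addr0.
case: ifP => tx.
  have lx : (0 < lev x)%N by apply: leq_trans tx.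
  by rewrite !eps_lev ?lev_e //; ring.
by rewrite insZ; ring.
Qed.

Definition vanish_above F := forall s, above s -> F s = 0.

(** Levels only grow under products and [eps] kills positive level, so a face of a list above [t] is
    again above [t] or zero. *)
Lemma vanish_act x F s : vanish_above F -> (t < lev x)%N || above s -> act x F s = 0.
Proof.
move=> vF; case: s => [|y s] /=.
  by rewrite orbF => lx; rewrite eps_lev ?mul0r //; apply: leq_trans lx.
move=> h; rewrite vF ?mulr0 //=.
case/or3P: h => [h|h|->]; last by rewrite orbT.
  by rewrite (leq_trans h (lev_mull _ _)).
by rewrite (leq_trans h (lev_mulr _ _)).
Qed.

Lemma vanish_rcob F : vanish_above F -> vanish_above (rcob F).
Proof.
move=> vF s; elim: s F vF => [|x s IH] F vF //= h.
rewrite (vanish_act vF h) oppr0 add0r.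
case/orP: h => h.
  rewrite (@eq_rcob _ (fun=> 0 * 0)) ?rcobZ ?mul0r ?oppr0 // => l _.
  by rewrite vF ?mul0r //= h.
by rewrite IH ?oppr0 // => l hl; rewrite vF //= hl orbT.
Qed.

Lemma vanish_ins F : vanish_above F -> vanish_above (ins F).
Proof.
move=> vF s; elim: s F vF => [|x s IH] F vF //= h.
case: ifP => tx; first by rewrite vF ?mulr0 ?oppr0 //= h orbT.
have lx : (t < lev x)%N = false by apply: contraFF tx; apply: ltnW.
move: h; rewrite lx /= => h.
by rewrite IH ?oppr0 // => l hl; rewrite vF //= hl orbT.
Qed.

(** The homotopy formula, by induction on the position of the first entry of level at least [t].
    Faces that would move this entry forward land in stage [j], where [F] vanishes. *)
Lemma ins_rcob_good j F s : (forall l, good j l -> F l = 0) -> good j.+1 s ->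
  rcob (ins F) s + ins (rcob F) s = F s.
Proof.
elim: s j F => [|x s IH] j F vF // gs.
have vaF : vanish_above F by move=> l hl; apply: vF; rewrite /good hl.
have [hs|/negbTE ns] := boolP (above (x :: s)).
  rewrite (vaF _ hs) vanish_rcob //; last exact: vanish_ins.
  by rewrite vanish_ins ?addr0 //; apply: vanish_rcob.
move: gs; rewrite /good ns orFb /=; move: ns => /=.
case: ifP => tx.
  have lx : (0 < lev x)%N by apply: leq_trans tx.
  move=> /negbT; rewrite negb_or -leqNgt => /andP[xt _] _.
  have tE : t = lev x by apply/eqP; rewrite eqn_leq tx xt.
  have -> : rcob (fun l => - (eta x * F [:: e x, x & l])) s
     = - eta x * rcob (fun l => F [:: e x, x & l]) s.
    by rewrite -rcobZ; apply: eq_rcob => l _; ring.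
  rewrite mul_e // mulrDr mulrN.
  have -> : act x (ins F) s = - eta x * act x (fun l => F (e x :: l)) s.
    case: s {IH} => [|y s] /=; first by rewrite eps_lev //; ring.
    rewrite (leq_trans tx (lev_mull _ _)).
    (* Either the product keeps the level of [x], hence also [e] and [eta], or it rises above [t]
       and [F] vanishes on both sides. *)
    have [exy|lt] := eqVneq (lev (mul x y)) (lev x).
      by rewrite e_mul // eta_mul //; ring.
    have lt' : (t < lev (mul x y))%N by rewrite tE ltn_neqAle eq_sym lt lev_mull.
    by rewrite !vaF ?mulr0 ?oppr0 ?mulr0 //= lt' ?orbT.
  (* All other faces cancel; the one that merges [e x] into [x] survives with coefficient 1. *)
  have := eta_w lx; move: (rcob _ _) (act _ _ _) => A B E.
  transitivity ((eta x * w (e x) x) * F (x :: s)); last by rewrite E mul1r.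
  by ring.
move=> /negbT; rewrite negb_or /= => /andP[_ ns] /andP[hs fs].
have -> : rcob (fun l => - ins (fun l0 => F (x :: l0)) l) s
   = - rcob (ins (fun l => F (x :: l))) s.
  by rewrite -mulN1r -rcobZ; apply: eq_rcob => l _; ring.
have -> : ins (fun l => - act x F l - rcob (fun l0 => F (x :: l0)) l) s
   = - ins (act x F) s - ins (rcob (fun l => F (x :: l))) s.
  rewrite -[- ins _ _]mulN1r -[- ins (rcob _) _]mulN1r -ins_lin.
  by apply: eq_ins => l _; ring.
(* The entry in question lies behind [x], so [j] is positive and [F] vanishes on every list whose
   first entry has level at least [t]. *)
case: j vF fs => // j vF; rewrite ltnS => fs.
have IHs : rcob (ins (fun l => F (x :: l))) s + ins (rcob (fun l => F (x :: l))) s = F (x :: s).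
  apply: (IH j); last by rewrite /good hs fs orbT.
  move=> l /orP[al|/andP[h f]]; apply: vF; first by rewrite /good /= al orbT.
  by rewrite /good /= tx h /= ltnS f orbT.
(* Insertion and merging commute unless one of them puts an entry of level at least [t] in front,
   and then both sides are zero. *)
suff -> : ins (act x F) s = act x (ins F) s by rewrite -IHs; ring.
have v0 z l : (t <= lev z)%N -> F (z :: l) = 0.
  by move=> tz; apply: vF; rewrite /good /= tz /= orbT.
case: s {IH IHs ns hs fs} => [|y s] /=; first by rewrite mulr0.
have [ty|ty] := leqP t (lev y).
  rewrite (leq_trans ty (lev_mulr _ _)) !v0 ?mulr0 ?oppr0 ?mulr0 //.
    by rewrite lev_e (leq_trans ty (lev_mulr _ _)).
  by apply: leq_trans (lev_mulr _ _); rewrite lev_e.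
rewrite insZ; case: ifP => txy; last by ring.
rewrite !v0 ?lev_e // (@eq_ins _ (fun=> 0 * 0)); last by move=> l _; rewrite v0 ?mul0r.
by rewrite insZ; ring.
Qed.

Lemma ins_lscob_good j F s : (forall l, good j l -> F l = 0) -> good j.+1 s ->
  lscob (ins F) s + ins (lscob F) s = F s.
Proof.
move=> vF gs; rewrite -[RHS](ins_rcob_good vF gs) -[RHS]add0r -(ins_lcob F s).
rewrite /lscob.
have -> : ins (fun l => lcob F l + rcob F l) s = 1 * ins (lcob F) s + 1 * ins (rcob F) s.
  by rewrite -ins_lin; apply: eq_ins => l _; ring.
by ring.
Qed.

Lemma ins_low F s : ~~ has (fun x => (t <= lev x)%N) s -> ins F s = 0.
Proof.
elim: s F => [|x s IH] F //=; rewrite negb_or => /andP[/negbTE -> h].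
by rewrite IH ?oppr0.
Qed.

End Level.

Lemma lcob_above t F : vanish_above t F -> vanish_above t (lcob F).
Proof.
move=> vF [|x s] //= /orP[lx|h]; last by rewrite vF ?mulr0.
by rewrite eps_lev ?mul0r //; apply: leq_ltn_trans lx.
Qed.

Lemma vanish_lscob t F : vanish_above t F -> vanish_above t (lscob F).
Proof. by move=> vF s h; rewrite /lscob (lcob_above vF h) (vanish_rcob vF h) addr0. Qed.

Hypothesis lev_mul0 : forall x y, lev x = 0%N -> lev y = 0%N -> lev (mul x y) = 0%N.

Definition vanish_low F := forall s, ~~ above 0 s -> F s = 0.

Lemma rcob_low F : vanish_low F -> vanish_low (rcob F).
Proof.
move=> vF s; elim: s F vF => [|x s IH] F vF //=.
rewrite negb_or lt0n negbK => /andP[/eqP x0 s0].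
rewrite IH // ?subr0; last by move=> l hl; rewrite vF //= x0.
case: s s0 {IH} => [|y s] /=; first by rewrite vF // mulr0 oppr0.
rewrite negb_or lt0n negbK => /andP[/eqP y0 s0].
by rewrite vF ?mulr0 ?oppr0 //= lev_mul0.
Qed.

Lemma lscob_low F : vanish_low F -> vanish_low (lscob F).
Proof.
move=> vF s h; rewrite /lscob rcob_low // addr0.
by case: s h => //= x s; rewrite negb_or => /andP[_ /vF ->]; rewrite mulr0.
Qed.

End ListCochains.

(** * Translation between lists and the tuples of the bar complex *)

Section Coding.
Variables (k : comPzRingType) (D : finType) (d0 : D).

Definition lst n (a : tup D n) : seq D := codom a.
Definition unl n (s : seq D) : tup D n := [ffun j : 'I_n => nth d0 s j].
(** Extension by zero to the other lengths, which makes a cochain of one degree an argument of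
    [lscob] and [ins]. *)
Definition ext n (phi : chains k D n) (s : seq D) : k :=
  if size s == n then phi (unl n s) else 0.

Lemma size_lst n (a : tup D n) : size (lst a) = n.
Proof. by rewrite size_codom card_ord. Qed.

Lemma nth_lst n (a : tup D n) (i : 'I_n) : nth d0 (lst a) i = a i.
Proof. by rewrite (nth_map i) ?size_enum_ord // nth_ord_enum. Qed.

Lemma lstK n : cancel (@lst n) (unl n).
Proof. by move=> a; apply/ffunP => i; rewrite ffunE nth_lst. Qed.

Lemma unlK n s : size s = n -> lst (unl n s) = s.
Proof.
move=> sn; apply: (@eq_from_nth _ d0); rewrite size_lst // => i lt_in.
by rewrite (nth_lst _ (Ordinal lt_in)) ffunE.
Qed.

Lemma ext_lst n (phi : chains k D n) a : ext phi (lst a) = phi a.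
Proof. by rewrite /ext size_lst eqxx lstK. Qed.

Lemma nth_lst_at n (a : tup D n.+1) (m : nat) : (m <= n)%N -> at_ a m = nth d0 (lst a) m.
Proof. by move=> mn; rewrite /at_ -nth_lst inordK. Qed.

Lemma lst_tail n (a : tup D n.+1) : lst (tail_ a) = behead (lst a).
Proof.
apply: (@eq_from_nth _ d0); first by rewrite size_behead !size_lst.
move=> i; rewrite size_lst => lt_in.
by rewrite (nth_lst _ (Ordinal lt_in)) ffunE nth_lst_at ?nth_behead.
Qed.

Lemma lst_init n (a : tup D n.+1) : lst (init_ a) = take n (lst a).
Proof.
apply: (@eq_from_nth _ d0); first by rewrite size_take !size_lst ltnSn.
move=> i; rewrite size_lst => lt_in.
by rewrite (nth_lst _ (Ordinal lt_in)) ffunE nth_lst_at ?nth_take //; apply: ltnW.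
Qed.

Lemma lst_merge n (a : tup D n.+1) (i : 'I_n) d :
  lst (merge_ a i d) = take i (lst a) ++ d :: drop i.+2 (lst a).
Proof.
have ti : size (take i (lst a)) = i.
  by rewrite size_takel // size_lst ltnW // ltnS ltnW.
apply: (@eq_from_nth _ d0).
  rewrite size_cat /= ti size_drop !size_lst; have := ltn_ord i; lia.
move=> j; rewrite size_lst => lt_jn.
rewrite (nth_lst _ (Ordinal lt_jn)) ffunE nth_cat ti /=.
case: ltnP => ij; first by rewrite nth_lst_at ?nth_take // ltnW.
have [e|ne] := eqVneq (Ordinal lt_jn) i; first by rewrite -e subnn.
have nej : (j == i)%N = false by apply: contraNF ne => /eqP e; apply/eqP/val_inj.
have lt_ij : (i < j)%N by rewrite ltn_neqAle eq_sym nej ij.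
rewrite -(subnKC lt_ij) addSnnS addKn /= nth_drop nth_lst_at.
  by congr nth; lia.
by lia.
Qed.

(** A perfect pairing for which [bd] and [cobd] are adjoint; through it statements on chains follow
    from statements on cochains. *)
Definition pairing n (z phi : chains k D n) : k := \sum_a z a * phi a.
Definition basis_ n (b : tup D n) : chains k D n := [ffun a => (a == b)%:R].

Lemma pairing_basis n (z : chains k D n) b : pairing z (basis_ b) = z b.
Proof.
rewrite /pairing (bigD1 b) //= ffunE eqxx mulr1 big1 ?addr0 // => a /negbTE ab.
by rewrite ffunE ab mulr0.
Qed.

Lemma sum_pred1 n (b : tup D n) (phi : tup D n -> k) :
  \sum_c (c == b)%:R * phi c = phi b.
Proof.
rewrite (bigD1 b) //= eqxx mul1r big1 ?addr0 // => c /negbTE ->.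
by rewrite mul0r.
Qed.

Lemma ext_basis n (phi : chains k D n) s : ext phi s = \sum_b phi b * ext (basis_ b) s.
Proof.
rewrite /ext; case: ifP => _; last by rewrite big1 // => b _; rewrite mulr0.
rewrite -{1}(sum_pred1 (unl n s) phi); apply: eq_bigr => b _.
by rewrite ffunE mulrC eq_sym.
Qed.

Section Twisted.
Variables (mul : D -> D -> D) (w : D -> D -> k) (eps : D -> k).
Variable mult : D -> D -> D -> k.
Hypothesis multE : forall x y d, mult x y d = if d == mul x y then w x y else 0.

Lemma pairing_bd n (z : chains k D n.+1) phi :
  pairing (bd mult eps z) phi = pairing z (cobd mult eps phi).
Proof.
rewrite /pairing; under eq_bigr do rewrite ffunE mulr_suml.
rewrite exchange_big; apply: eq_bigr => a _; rewrite ffunE mulr_sumr.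
by apply: eq_bigr => b _; rewrite mulrA.
Qed.

Lemma pairing_inj n (y z : chains k D n) :
  (forall phi, pairing y phi = pairing z phi) -> y = z.
Proof. by move=> e; apply/ffunP => b; rewrite -!pairing_basis e. Qed.

(** Each unfolding of the recursion contributes the first summand and shifts the signs of the
    others, which recovers the alternating sum of the bar complex. *)
Lemma rcobE n (F : seq D -> k) s : size s = n.+1 ->
  rcob mul w eps F s =
    \sum_(i < n) (-1) ^+ i.+1 *
       (w (nth d0 s i) (nth d0 s i.+1) *
        F (take i s ++ mul (nth d0 s i) (nth d0 s i.+1) :: drop i.+2 s))
    + (-1) ^+ n.+1 * eps (nth d0 s n) * F (take n s).
Proof.
elim: n F s => [|n IH] F [|x [|y s]] //.
  by move=> _; rewrite big_ord0 /=; ring.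
case=> ss.
rewrite [LHS]/= -/(rcob mul w eps (fun l => F (x :: l)) (y :: s)) IH; last by rewrite /= ss.
rewrite big_ord_recl /= drop0 opprD addrA -sumrN; congr (_ + _ + _).
- by ring.
- by apply: eq_bigr => i _; rewrite /= [in RHS]exprS; ring.
- by rewrite [in RHS]exprS; ring.
Qed.

Lemma cobdE n (phi : chains k D n) a :
  cobd mult eps phi a = lscob mul w eps (ext phi) (lst a).
Proof.
rewrite ffunE /lscob (rcobE _ (size_lst a)) /bd_coef addrA.
have -> : lcob eps (ext phi) (lst a) = eps (at_ a 0) * phi (tail_ a).
  rewrite (nth_lst_at a (leq0n n)) -(ext_lst phi) lst_tail.
  by case: (lst a) (size_lst a) => [|x s].
under eq_bigr do rewrite !mulrDl -!mulrA.
rewrite !big_split /=; congr (_ + _ + _).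
- by rewrite -mulr_sumr sum_pred1.
- under eq_bigr do rewrite mulr_suml.
  rewrite exchange_big /=; apply: eq_bigr => i _.
  under eq_bigr do rewrite -mulrA mulr_suml.
  rewrite -mulr_sumr; congr (_ * _).
  (* By [multE] a product of basis elements is a multiple of a single basis element, so only one [d]
     contributes. *)
  rewrite exchange_big /= (bigD1 (mul (at_ a i) (at_ a i.+1))) //=.
  rewrite [X in _ + X]big1 ?addr0; last first.
    move=> d /negbTE nd; rewrite big1 // => b _.
    by rewrite multE nd !mul0r.
  under eq_bigr do rewrite -mulrA.
  rewrite -mulr_sumr sum_pred1 multE eqxx.
  rewrite -!nth_lst_at //; last by rewrite ltnW.
  by rewrite -lst_merge ext_lst.
- by rewrite -!mulr_sumr sum_pred1 -lst_init ext_lst -nth_lst_at // mulrA.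
Qed.

End Twisted.
End Coding.

(** * Linearity of the differentials *)

Section Linear.
Variables (k : comPzRingType) (D : finType) (mult : D -> D -> D -> k) (eps : D -> k).

Lemma cobdB n (f g : chains k D n) : cobd mult eps (f - g) = cobd mult eps f - cobd mult eps g.
Proof.
apply/ffunP => a; rewrite !ffunE -sumrB; apply: eq_bigr => b _.
by rewrite !ffunE mulrBr.
Qed.

Lemma cobd0 n : cobd mult eps (0 : chains k D n) = 0.
Proof. by rewrite -[0]subr0 cobdB subrr. Qed.

Lemma bdB n (f g : chains k D n.+1) : bd mult eps (f - g) = bd mult eps f - bd mult eps g.
Proof.
apply/ffunP => a; rewrite !ffunE -sumrB; apply: eq_bigr => b _.
by rewrite !ffunE mulrBl.
Qed.

Lemma bdD n (f g : chains k D n.+1) : bd mult eps (f + g) = bd mult eps f + bd mult eps g.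
Proof.
apply/ffunP => a; rewrite !ffunE -big_split; apply: eq_bigr => b _.
by rewrite !ffunE mulrDl.
Qed.

Lemma cobdD n (f g : chains k D n) : cobd mult eps (f + g) = cobd mult eps f + cobd mult eps g.
Proof.
apply/ffunP => a; rewrite !ffunE -big_split; apply: eq_bigr => b _.
by rewrite !ffunE mulrDr.
Qed.

Lemma bd0 n : bd mult eps (0 : chains k D n.+1) = 0.
Proof. by rewrite -[0]subr0 bdB subrr. Qed.

Lemma pairingBl n (x y phi : chains k D n) : pairing (x - y) phi = pairing x phi - pairing y phi.
Proof. by rewrite /pairing -sumrB; apply: eq_bigr => a _; rewrite !ffunE mulrBl. Qed.

End Linear.

(** * Acyclicity of the part of positive level *)

Section Acyclic.
Variables (k : comPzRingType) (D : finType) (d0 : D).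
Variables (mul : D -> D -> D) (w : D -> D -> k) (eps : D -> k).
Variable mult : D -> D -> D -> k.
Hypothesis multE : forall x y d, mult x y d = if d == mul x y then w x y else 0.
Hypothesis mulA : associative mul.
Hypothesis wA : forall x y z, w x y * w (mul x y) z = w y z * w x (mul y z).
Hypothesis epsM : forall x y, eps x * eps y = w x y * eps (mul x y).

Notation cobd := (cobd mult eps).
Notation bd := (bd mult eps).

Lemma cobd_cobd n (phi : chains k D n) : cobd (cobd phi) = 0.
Proof.
apply/ffunP => a; rewrite (cobdE d0 _ multE) [RHS]ffunE -[RHS](lscob_lscob mulA wA epsM (ext d0 phi) (lst a)).
apply: eq_lscob => l; rewrite size_lst => -[sl].
by rewrite /ext sl eqxx (cobdE d0 _ multE) unlK.
Qed.

Lemma bd_bd n (z : chains k D n.+2) : bd (bd z) = 0.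
Proof.
apply: pairing_inj => phi; rewrite !pairing_bd cobd_cobd /pairing.
by rewrite !big1 // => a _; rewrite ffunE ?mulr0 ?mul0r.
Qed.

Variables (lev : D -> nat) (e : D -> D) (eta : D -> k).
Hypothesis lev_mull : forall x y, (lev x <= lev (mul x y))%N.
Hypothesis lev_mulr : forall x y, (lev y <= lev (mul x y))%N.
Hypothesis eps_lev : forall x, (0 < lev x)%N -> eps x = 0.
Hypothesis lev_e : forall x, lev (e x) = lev x.
Hypothesis mul_e : forall x, (0 < lev x)%N -> mul (e x) x = x.
Hypothesis eta_w : forall x, (0 < lev x)%N -> eta x * w (e x) x = 1.
Hypothesis e_mul : forall x y, lev (mul x y) = lev x -> e (mul x y) = e x.
Hypothesis eta_mul : forall x y, (0 < lev x)%N -> lev (mul x y) = lev x ->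
  eta (mul x y) = eta x.

Hypothesis lev_mul0 : forall x y, lev x = 0%N -> lev y = 0%N -> lev (mul x y) = 0%N.

Definition insC t n (phi : chains k D n.+1) : chains k D n :=
  [ffun a => ins lev e eta t (ext d0 phi) (lst a)].

(** The transpose of [insC] under [pairing]. *)
Definition insT t n (z : chains k D n) : chains k D n.+1 :=
  [ffun b => \sum_a z a * ins lev e eta t (ext d0 (basis_ k b)) (lst a)].

Lemma pairing_insT t n (z : chains k D n) phi :
  pairing (insT t z) phi = pairing z (insC t phi).
Proof.
rewrite /pairing; under eq_bigr do rewrite ffunE mulr_suml.
rewrite exchange_big; apply: eq_bigr => a _; rewrite ffunE.
rewrite (eq_ins _ _ _ _ (G := fun l => \sum_b phi b * ext d0 (basis_ k b) l)); last first.
  by move=> l _; apply: ext_basis.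
by rewrite ins_sum mulr_sumr; apply: eq_bigr => b _; rewrite -mulrA [phi b * _]mulrC.
Qed.

Notation good := (good lev).

Lemma insC_good t j n (phi : chains k D n.+1) a : (0 < t)%N ->
  (forall b, good t j (lst b) -> phi b = 0) -> good t j.+1 (lst a) ->
  cobd (insC t phi) a + insC t (cobd phi) a = phi a.
Proof.
move=> t0 vphi ga; rewrite (cobdE d0 _ multE) [insC _ _ _]ffunE -(ext_lst d0 phi).
have vF l : good t j l -> ext d0 phi l = 0.
  by rewrite /ext; case: eqP => // sl gl; rewrite vphi // unlK.
rewrite -(ins_lscob_good lev_mull lev_mulr eps_lev lev_e mul_e eta_w
           e_mul eta_mul t0 vF ga).
congr (_ + _).
  apply: eq_lscob => l; rewrite size_lst => -[sl].
  by rewrite /ext sl eqxx ffunE unlK.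
apply: eq_ins => l; rewrite size_lst => sl.
by rewrite /ext sl eqxx (cobdE d0 _ multE) unlK.
Qed.

Definition low n (a : tup D n) := ~~ above lev 0 (lst a).

Lemma good0 t s : good t 0 s = above lev t s.
Proof. by rewrite /good ltn0 andbF orbF. Qed.

(** Once [j] reaches the length, the condition on the position is void: the filtration at level
    [t.+1] ends where the one at level [t] begins. *)
Lemma good_full t j s : (size s <= j)%N -> good t.+1 j s = above lev t s.
Proof.
move=> sj; rewrite /good; apply/orP/idP => [[h|/andP[] //]|h].
  by apply: sub_has h => x; apply: ltn_trans.
by right; rewrite /above in h; rewrite h (leq_trans _ sj) // -has_find.
Qed.

(** On stage [j.+1] the homotopy formula identifies [phi'] with [insC t (cobd phi)], which is zero
    for a cocycle. *)
Lemma cocycle_step t j m (phi : chains k D m.+1) : (0 < t)%N -> cobd phi = 0 ->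
  (forall a, good t j (lst a) -> phi a = 0) -> (forall a, low a -> phi a = 0) ->
  let phi' := phi - cobd (insC t phi) in
  [/\ cobd phi' = 0, forall a, good t j.+1 (lst a) -> phi' a = 0
    & forall a, low a -> phi' a = 0].
Proof.
move=> t0 c g l phi'; split.
- by rewrite cobdB c cobd_cobd subrr.
- move=> a ga; rewrite !ffunE -{1}(insC_good t0 g ga) c [insC _ _ _]ffunE.
  rewrite (eq_ins _ _ _ _ (G := fun=> 0 * 0)) ?insZ; last first.
    by move=> s _; rewrite /ext ffunE mul0r if_same.
  by rewrite mul0r addr0 ffunE subrr.
move=> a la; rewrite ffunE [X in _ + X]ffunE l // (cobdE d0 _ multE).
rewrite (lscob_low _ _ lev_mul0) ?subrr // => s ls.
rewrite /ext; case: eqP => // ss; rewrite ffunE unlK //; apply: ins_low.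
by apply: contra ls; apply: sub_has => x; apply: leq_trans.
Qed.

(** The set where the cocycle vanishes grows by stages: for each level, from the highest down, [j]
    runs up to the length. The last stage and the low tuples together are everything. *)
Lemma cocycle_acyclic n (phi : chains k D n) :
  cobd phi = 0 -> (forall a, low a -> phi a = 0) -> coboundaries mult eps phi.
Proof.
case: n phi => [|m] phi c l.
  apply/ffunP => a; rewrite ffunE l // /low; apply/hasPn => x.
  by have := size_lst a; case: (lst a).
suff main t : forall j phi, cobd phi = 0 -> (forall a : tup D m.+1, good t.+1 j (lst a) -> phi a = 0) ->
    (forall a, low a -> phi a = 0) -> exists psi : chains k D m, cobd psi = phi.
  (* The first stage is empty, as no entry exceeds the maximal level. *)
  apply: (main (\max_x lev x) 0%N) => // a; rewrite good0 => h; exfalso.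
  move: h; apply/negP/hasPn => x _; rewrite -leqNgt.
  by apply: leq_trans (leqnSn _); apply: leq_bigmax.
elim: t => [|t IHt] j {}phi {}c g {}l.
all: move Ei : (m.+1 - j)%N => i; elim: i j phi c g l Ei => [|i IHi] j phi c g l Ei.
- exists 0; rewrite cobd0; apply/ffunP => a; rewrite ffunE.
  have [/l ->//|] := boolP (low a); rewrite negbK => h.
  by rewrite g // good_full // size_lst; lia.
- have [c' g' l'] := cocycle_step (ltn0Sn _) c g l.
  have [|psi e'] := IHi _ _ c' g' l'; first by lia.
  by exists (psi + insC 1 phi); rewrite cobdD e' subrK.
- apply: (IHt 0%N) => // a ga; apply: g; rewrite good_full; first by rewrite -good0.
  by rewrite size_lst; lia.
- have [c' g' l'] := cocycle_step (ltn0Sn _) c g l.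
  have [|psi e'] := IHi _ _ c' g' l'; first by lia.
  by exists (psi + insC t.+2 phi); rewrite cobdD e' subrK.
Qed.

(** For a tuple [b] outside stage [j] the basis cochain of [b] vanishes on stage [j], so [insC_good]
    applies to it on the support of [z]; transposing gives the value of [z'] at [b]. *)
Lemma cycle_step t j m (z : chains k D m.+1) : (0 < t)%N -> bd z = 0 ->
  (forall a, ~~ good t j.+1 (lst a) -> z a = 0) ->
  let z' := z - bd (insT t z) in
  bd z' = 0 /\ forall a, ~~ good t j (lst a) -> z' a = 0.
Proof.
move=> t0 c g z'; split; first by rewrite bdB c bd_bd subrr.
move=> b nb; rewrite -(pairing_basis z') pairingBl pairing_bd pairing_insT.
have cz : pairing z (cobd (insC t (basis_ k b))) = 0.
  by rewrite -pairing_bd c /pairing big1 // => a _; rewrite ffunE mul0r.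
rewrite -[X in _ - X]add0r -cz /pairing -big_split -sumrB big1 // => a _ /=.
have [ga|/g ->] := boolP (good t j.+1 (lst a)); last by ring.
rewrite -mulrDr (@insC_good t j _ (basis_ k b)) ?subrr // => b' gb'.
by rewrite ffunE; case: eqP => // eb; rewrite -eb gb' in nb.
Qed.

(** The stages are run backwards: the support shrinks as [j] falls to 0, then the level rises by
    one, until it exceeds the maximum and the support is empty. *)
Lemma cycle_acyclic n (z : chains k D n) :
  cycles mult eps z -> (forall a, low a -> z a = 0) -> boundaries mult eps z.
Proof.
case: n z => [|m] z c l.
  exists 0; rewrite bd0; apply/ffunP => a; rewrite ffunE l // /low; apply/hasPn => x.
  by have := size_lst a; case: (lst a).
suff main i : forall t j (z : chains k D m.+1), bd z = 0 ->
    (forall a, ~~ good t.+1 j (lst a) -> z a = 0) ->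
    (\max_x lev x - t = i)%N -> boundaries mult eps z.
  (* With [j] the full length, stage [good 1] consists of all tuples that are not low. *)
  apply: (main _ 0%N m.+1 z c _ erefl) => a.
  by rewrite good_full ?size_lst // => h; apply: l.
clear z c l; elim: i => [|i IHi] t j z c; elim: j z c => [|j IHj] z c g Ei.
- exists 0; rewrite bd0; apply/ffunP => a; rewrite ffunE g // good0.
  apply/hasPn => x _; rewrite -leqNgt; apply: leq_trans (leqnSn _).
  by apply: leq_trans (leq_bigmax x) _; rewrite -subn_eq0 Ei.
- have [c' g'] := cycle_step (ltn0Sn _) c g.
  have [y e'] := IHj _ c' g' Ei.
  by exists (y + insT t.+1 z); rewrite bdD e' subrK.
- apply: (IHi t.+1 m.+1) => //; last by lia.
  move=> a; rewrite good_full ?size_lst // => h; apply: g; by rewrite good0.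
- have [c' g'] := cycle_step (ltn0Sn _) c g.
  have [y e'] := IHj _ c' g' Ei.
  by exists (y + insT t.+1 z); rewrite bdD e' subrK.
Qed.

End Acyclic.

(** * Splitting off the subalgebra of level zero *)

Section ListMorphism.
Variables (k : comPzRingType) (D D' : Type) (io : D' -> D).
Variables (mul : D -> D -> D) (w : D -> D -> k) (eps : D -> k).
Variables (mul' : D' -> D' -> D') (w' : D' -> D' -> k) (eps' : D' -> k).
Hypothesis ioM : forall x y, mul (io x) (io y) = io (mul' x y).
Hypothesis io_w : forall x y, w (io x) (io y) = w' x y.
Hypothesis io_eps : forall x, eps (io x) = eps' x.

Lemma lscob_map F s :
  lscob mul w eps F (map io s) = lscob mul' w' eps' (fun l => F (map io l)) s.
Proof.
rewrite /lscob; congr (_ + _); first by case: s => //= x s; rewrite io_eps.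
elim: s F => //= x s IH F; rewrite IH; congr (- _ - _).
by case: s {IH} => [|y s] /=; rewrite ?io_eps // ioM io_w.
Qed.

End ListMorphism.

Section Comparison.
Variables (k : comPzRingType) (D D' : finType) (d0 : D) (d0' : D') (io : D' -> D).
Variables (mul : D -> D -> D) (w : D -> D -> k) (eps : D -> k) (mult : D -> D -> D -> k).
Variables (mul' : D' -> D' -> D') (w' : D' -> D' -> k) (eps' : D' -> k).
Variable mult' : D' -> D' -> D' -> k.
Hypothesis multE : forall x y d, mult x y d = if d == mul x y then w x y else 0.
Hypothesis multE' : forall x y d, mult' x y d = if d == mul' x y then w' x y else 0.
Hypothesis mulA : associative mul.
Hypothesis wA : forall x y z, w x y * w (mul x y) z = w y z * w x (mul y z).
Hypothesis epsM : forall x y, eps x * eps y = w x y * eps (mul x y).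
Variables (lev : D -> nat) (e : D -> D) (eta : D -> k).
Hypothesis lev_mull : forall x y, (lev x <= lev (mul x y))%N.
Hypothesis lev_mulr : forall x y, (lev y <= lev (mul x y))%N.
Hypothesis eps_lev : forall x, (0 < lev x)%N -> eps x = 0.
Hypothesis lev_e : forall x, lev (e x) = lev x.
Hypothesis mul_e : forall x, (0 < lev x)%N -> mul (e x) x = x.
Hypothesis eta_w : forall x, (0 < lev x)%N -> eta x * w (e x) x = 1.
Hypothesis e_mul : forall x y, lev (mul x y) = lev x -> e (mul x y) = e x.
Hypothesis eta_mul : forall x y, (0 < lev x)%N -> lev (mul x y) = lev x ->
  eta (mul x y) = eta x.
Hypothesis ioM : forall x y, mul (io x) (io y) = io (mul' x y).
Hypothesis io_w : forall x y, w (io x) (io y) = w' x y.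
Hypothesis io_eps : forall x, eps (io x) = eps' x.
Hypothesis io_inj : injective io.
Hypothesis lev_io : forall x, lev (io x) = 0%N.
Hypothesis lev0_io : forall x, lev x = 0%N -> exists y, x = io y.

Lemma lev_mul0 x y : lev x = 0%N -> lev y = 0%N -> lev (mul x y) = 0%N.
Proof. by move=> /lev0_io[x' ->] /lev0_io[y' ->]; rewrite ioM lev_io. Qed.

Notation cobd := (cobd mult eps).
Notation bd := (bd mult eps).
Notation cobd' := (Defs.cobd mult' eps').
Notation bd' := (Defs.bd mult' eps').

Definition iot n (a : tup D' n) : tup D n := [ffun i => io (a i)].
Definition res n (z : chains k D n) : chains k D' n := [ffun a => z (iot a)].
Definition exz n (z : chains k D' n) : chains k D n :=
  [ffun a => \sum_b (a == iot b)%:R * z b].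

Lemma iot_inj n : injective (@iot n).
Proof.
move=> a b /ffunP ab; apply/ffunP => i; apply: io_inj.
by have := ab i; rewrite !ffunE.
Qed.

Lemma lst_iot n (a : tup D' n) : lst (iot a) = map io (lst a).
Proof. by rewrite /lst /codom -map_comp; apply: eq_map => i; rewrite /= ffunE. Qed.

Lemma low_iot n (a : tup D' n) : low lev (iot a).
Proof. by rewrite /low lst_iot; apply/hasPn => x /mapP[y _ ->]; rewrite lev_io. Qed.

Lemma lowP n (a : tup D n) : low lev a -> exists b, a = iot b.
Proof.
move=> /hasPn la; have /fin_all_exists[b bP] i : exists y, a i = io y.
  apply: lev0_io; apply/eqP; rewrite -leqn0 leqNgt; apply: la.
  by apply/codomP; exists i.
by exists [ffun i => b i]; apply/ffunP => i; rewrite !ffunE.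
Qed.

Lemma exz_iot n (z : chains k D' n) a : exz z (iot a) = z a.
Proof.
rewrite ffunE (bigD1 a) //= eqxx mul1r big1 ?addr0 // => b /negbTE nb.
by rewrite (inj_eq (@iot_inj n)) eq_sym nb mul0r.
Qed.

Lemma exz_notlow n (z : chains k D' n) a : ~~ low lev a -> exz z a = 0.
Proof.
move=> la; rewrite ffunE big1 // => b _; case: eqP => [ab|_]; last by rewrite mul0r.
by rewrite ab low_iot in la.
Qed.

Lemma exzK n (z : chains k D' n) : res (exz z) = z.
Proof. by apply/ffunP => a; rewrite ffunE exz_iot. Qed.

Lemma res_cobd n (phi : chains k D n) : res (cobd phi) = cobd' (res phi).
Proof.
apply/ffunP => a; rewrite ffunE (cobdE d0 _ multE) (cobdE d0' _ multE') lst_iot.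
rewrite (lscob_map ioM io_w io_eps); apply: eq_lscob => l.
rewrite size_lst => -[sl]; rewrite /ext size_map sl eqxx ffunE.
congr (phi _); apply/ffunP => i; rewrite !ffunE (nth_map d0') // sl.
exact: ltn_ord.
Qed.

(** On low tuples this is [res_cobd]. Elsewhere both sides vanish, because positive level survives
    in every face that [eps] does not kill. *)
Lemma cobd_exz n (phi : chains k D' n) : cobd (exz phi) = exz (cobd' phi).
Proof.
apply/ffunP => a; have [/lowP[b ->]|la] := boolP (low lev a).
  have := res_cobd (exz phi); rewrite exzK => /ffunP/(_ b).
  by rewrite [LHS]ffunE => ->; rewrite exz_iot.
rewrite exz_notlow // (cobdE d0 _ multE).
apply: (vanish_lscob w lev_mull lev_mulr eps_lev (t := 0)); last by move: la; rewrite negbK.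
move=> s hs; rewrite /ext; case: eqP => // ss; rewrite exz_notlow //.
by rewrite /low unlK // hs.
Qed.

Lemma pairing_res n (z : chains k D n) phi : pairing (res z) phi = pairing z (exz phi).
Proof.
rewrite /pairing; under [RHS]eq_bigr do rewrite ffunE mulr_sumr.
rewrite exchange_big; apply: eq_bigr => b _; rewrite ffunE.
rewrite (bigD1 (iot b)) //= eqxx mul1r big1 ?addr0 // => a /negbTE ->.
by rewrite mul0r mulr0.
Qed.

Lemma pairingC n (X : finType) (y z : chains k X n) : pairing y z = pairing z y.
Proof. by apply: eq_bigr => a _; rewrite mulrC. Qed.

(** Transposition exchanges [res] and [exz], so this is dual to [cobd_exz], just as [bd_exz] is dual
    to [res_cobd]. *)
Lemma res_bd n (z : chains k D n.+1) : res (bd z) = bd' (res z).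
Proof.
by apply: pairing_inj => phi; rewrite pairing_bd !pairing_res pairing_bd cobd_exz.
Qed.

Lemma bd_exz n (z : chains k D' n.+1) : bd (exz z) = exz (bd' z).
Proof.
apply: pairing_inj => phi; rewrite pairing_bd [LHS]pairingC -pairing_res.
by rewrite [RHS]pairingC -pairing_res res_cobd !(pairingC (res _)) pairingC pairing_bd pairingC.
Qed.

Lemma resB n (y z : chains k D n) : res (y - z) = res y - res z.
Proof. by apply/ffunP => a; rewrite !ffunE. Qed.

Lemma res_eq0 n (z : chains k D n) : res z = 0 -> forall a, low lev a -> z a = 0.
Proof. by move=> /ffunP z0 a /lowP[b ->]; have := z0 b; rewrite !ffunE. Qed.

Lemma res0 n : res (0 : chains k D n) = 0.
Proof. by apply/ffunP => a; rewrite !ffunE. Qed.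

Lemma exz0 n : exz (0 : chains k D' n) = 0.
Proof.
by apply/ffunP => a; rewrite !ffunE big1 // => b _; rewrite ffunE mulr0.
Qed.

Lemma res_linear (n : nat) (B' : chains k D' n -> Prop) : B' 0 ->
  (forall z z', B' (res (z + z') - (res z + res z'))) /\
  (forall a z, B' (res (fscale a z) - fscale a (res z))).
Proof.
move=> B0; split=> [z z'|a z]; set u := (u in B' u); suff -> : u = 0 by [].
  by apply/ffunP => a; rewrite !ffunE subrr.
by apply/ffunP => b; rewrite !ffunE subrr.
Qed.

(** Restriction is split by [exz]. If the restriction of [z] bounds [g], then [z - bd (exz g)]
    vanishes on low tuples and is a boundary by acyclicity. *)
Lemma Tor_iso_low n : Tor_iso mult eps mult' eps' n.
Proof.
exists (@res n).
have B0 : boundaries mult' eps' (0 : chains k D' n) by exists 0; apply: bd0.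
have [rD rZ] := res_linear B0; split=> //.
- by case: n {B0 rD rZ} => [|n] //= z Zz; rewrite -res_bd Zz res0.
- move=> z' Zz'; exists (exz z'); last by rewrite exzK subrr.
  by case: n {B0 rD rZ} z' Zz' => [|n] //= z' Zz'; rewrite bd_exz Zz' exz0.
move=> z Zz; split=> [[g bg]|[g <-]]; last by exists (res g); rewrite res_bd.
have [||y by_] := cycle_acyclic d0 multE mulA wA epsM lev_mull lev_mulr eps_lev lev_e
  mul_e eta_w e_mul eta_mul (z := z - bd (exz g)).
- case: n {B0 rD rZ} z Zz g bg => [|n] //= z Zz g _; rewrite bdB Zz.
  by rewrite (bd_bd d0 multE mulA wA epsM) subrr.
- by apply: res_eq0; rewrite resB bd_exz exzK bg subrr.
by exists (y + exz g); rewrite bdD by_ subrK.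
Qed.

Lemma Ext_iso_low n : Ext_iso mult eps mult' eps' n.
Proof.
exists (@res n).
have B0 : coboundaries mult' eps' (0 : chains k D' n).
  by case: n => //= n; exists 0; apply: cobd0.
have [rD rZ] := res_linear B0; split=> //.
- by move=> z Zz; rewrite /cocycles -res_cobd Zz res0.
- move=> z' Zz'; exists (exz z'); last by rewrite exzK subrr.
  by rewrite /cocycles cobd_exz Zz' exz0.
move=> z Zz; split; last first.
  by case: n {B0 rD rZ} z Zz => [|n] z _ /= => [->|[g <-]]; [apply: res0|exists (res g); rewrite res_cobd].
have acyc := cocycle_acyclic d0 multE mulA wA epsM lev_mull lev_mulr eps_lev lev_e
  mul_e eta_w e_mul eta_mul lev_mul0.
case: n {B0 rD rZ} z Zz => [|n] z Zz /=.
  by move=> /res_eq0 z0; apply: acyc Zz z0.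
case=> g bg; have [||y by_] := acyc _ (z - cobd (exz g)).
- by rewrite cobdB Zz (cobd_cobd d0 multE mulA wA epsM) subrr.
- by apply: res_eq0; rewrite resB cobd_exz exzK bg subrr.
by exists (y + exz g); rewrite cobdD by_ subrK.
Qed.

End Comparison.

Local Close Scope ring_scope.

(** * Walks alternating between two involutions *)

Section Walk.
Variables (T : finType) (al be : T -> T) (sg : T -> bool) (u : T).
Hypotheses (alK : involutive al) (beK : involutive be).
Hypothesis sg_al : forall x, sg (al x) = ~~ sg x.
Hypothesis sg_be : forall x, be x != x -> sg (be x) = ~~ sg x.
Hypothesis be_u : be u = u.

(* [v] is the first [be]-fixed point of the walk u, be (al u), be (al (be (al u))),
   ... that comes after [u]. *)
Lemma walk_end : exists v,
  [/\ be v = v, sg v = ~~ sg u,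
      forall P : T -> bool, P u -> (forall x, P x -> P (al x)) ->
        (forall x, P x -> P (be x)) -> P v
    & exists P : T -> bool, [/\ P u, forall x, P x -> P (al x),
        forall x, P x -> P (be x) & forall x, P x -> be x = x -> x = u \/ x = v]].
Proof.
pose f x := be (al x).
have f_inj : injective f by apply: inj_comp; apply: inv_inj.
(* The injective map [f] returns to [u], which is fixed by [be], so a first fixed point exists. *)
have exj : exists j, (0 < j) && (be (iter j f u) == iter j f u).
  by exists (fingraph.order f u); rewrite fingraph.order_gt0 fingraph.iter_order // be_u eqxx.
have [[|j] // /andP[_ /eqP fixj] minj] := ex_minnP exj.
have nfix i : 0 < i -> i <= j -> be (iter i f u) != iter i f u.
  move=> i0 ij; apply/negP => bi; have := minj i; rewrite i0 bi => /(_ isT).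
  by rewrite ltnNge ij.
have vE : iter j.+1 f u = al (iter j f u) by rewrite -fixj /= /f beK.
exists (iter j.+1 f u); split=> //.
- rewrite vE sg_al; congr (~~ _).
  (* Before the end every [al] flips the sign and the following [be] flips it back. *)
  have : j <= j by []; elim: {1 3}j => // i IH ij; rewrite -IH; last exact: ltnW.
  have := nfix i.+1 isT ij; rewrite /= {1}/f beK eq_sym => nf.
  by rewrite /f sg_be // sg_al negbK.
- move=> P Pu Pal Pbe; elim: j.+1 => //= i Pi; exact/Pbe/Pal.
(* The points of the walk; they are closed under both involutions because [be] fixes the two
   ends. *)
exists (fun x => [exists i : 'I_j.+1, (x == iter i f u) || (x == al (iter i f u))]); split.
- by apply/existsP; exists ord0; rewrite eqxx.
- move=> x /existsP[i xi]; apply/existsP; exists i.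
  by case/orP: xi => /eqP ->; rewrite ?alK eqxx ?orbT.
- move=> x /existsP[[i lt_ij] /= /orP[]/eqP ->].
    case: i lt_ij => [|i] lt_ij; first by apply/existsP; exists ord0; rewrite /= be_u eqxx.
    by apply/existsP; exists (Ordinal (ltnW lt_ij)); rewrite /= {1}/f beK eqxx orbT.
  move: lt_ij; rewrite ltnS leq_eqVlt => /orP[/eqP ->|lt_ij].
    by apply/existsP; exists ord_max; rewrite /= -vE fixj eqxx orbT.
  by apply/existsP; exists (Ordinal (n := j.+1) (m := i.+1) lt_ij); rewrite /= eqxx.
move=> x /existsP[[i lt_ij] /= /orP[]/eqP ->] fx.
  left; case: i lt_ij fx => // i lt_ij fx.
  by have := nfix i.+1 isT lt_ij; rewrite fx eqxx.
right; move: lt_ij; rewrite ltnS leq_eqVlt => /orP[/eqP e|lt_ij]; first by rewrite e -vE.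
by have := nfix i.+1 isT lt_ij; rewrite /= /f !fx eqxx.
Qed.

End Walk.

(** * Walled Brauer diagrams and colourings *)

Section Diagrams.
Variables r s : nat.
Notation N := (Nv r s).
Notation V := (vert r s).
Notation W := (wvert r s).
Notation diag := (wbdiag r s).
Implicit Types (d : diag) (u v : V) (f g h : {ffun 'I_N -> bool}).

(** Swapping the two sides of the wall in the right column turns both edge conditions into one:
    edges join vertices of opposite sign. *)
Definition wsign u : bool := u.1 (+) (u.2 < r).

Lemma walled_edgeE u v : walled_edge u v = (wsign v == ~~ wsign u).
Proof.
rewrite /walled_edge /wsign; case: u v => [[] i] [[] j] /=;
by case: (i < r); case: (j < r).
Qed.

Lemma is_wbP (p : {ffun V -> V}) :
  reflect (forall u, p (p u) = u /\ wsign (p u) = ~~ wsign u) (is_wb p).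
Proof.
apply: (iffP forallP) => h u; have := h u.
  by rewrite walled_edgeE => /and3P[/eqP -> _ /eqP ->].
case=> -> e; rewrite eqxx walled_edgeE e eqxx andbT /=.
by apply/eqP => pu; move: e; rewrite pu; case: (wsign u).
Qed.

Lemma diagK d : involutive (val d).
Proof. by move=> u; have /is_wbP/(_ u)[] := valP d. Qed.

Lemma wsign_diag d u : wsign (val d u) = ~~ wsign u.
Proof. by have /is_wbP/(_ u)[] := valP d. Qed.

Lemma diag_neq d u : val d u != u.
Proof. by apply/eqP => e; have := wsign_diag d u; rewrite e; case: (wsign u). Qed.

Definition colour f g u : bool := if u.1 then g u.2 else f u.2.
(** The entry at [f], [g] of the 0-1 matrix attached to [d]. *)
Definition compat d f g : bool := [forall u, colour f g (val d u) == colour f g u].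

Lemma compatP d f g :
  reflect (forall u, colour f g (val d u) = colour f g u) (compat d f g).
Proof. by apply: (iffP forallP) => h u; apply/eqP/h. Qed.

(** The indicator of the edge through [u] is a compatible colouring, so it must be true at [v] as
    well. *)
Lemma diag_colour d u v : u != v ->
  (forall f g, compat d f g -> colour f g u = colour f g v) -> val d u = v.
Proof.
move=> uv h; pose c x := (x == u) || (x == val d u).
have colE x : colour [ffun i => c (false, i)] [ffun i => c (true, i)] x = c x.
  by case: x => [[] i]; rewrite /colour /= ffunE.
have cd : compat d [ffun i => c (false, i)] [ffun i => c (true, i)].
  apply/compatP => x; rewrite !colE /c (can_eq (diagK d)) orbC; congr (_ || _).
  by apply/eqP/eqP => [<-|->]; rewrite diagK.
have := h _ _ cd; rewrite !colE /c eqxx [v == u]eq_sym (negbTE uv) /=.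
by move/esym/eqP.
Qed.

Lemma compat_inj d d' : (forall f g, compat d f g = compat d' f g) -> d = d'.
Proof.
move=> e; apply/val_inj/ffunP => u; apply: diag_colour.
  by rewrite eq_sym diag_neq.
by move=> f g; rewrite e => /compatP/(_ u).
Qed.

Section Composite.
Variables d1 d2 : diag.

(* The vertices of [d1] (tag [false]) and [d2] (tag [true]) before gluing: [al]
   follows the edges, [be] exchanges the two copies of each middle vertex. *)
Let dart := (bool * V)%type.
Let al (p : dart) : dart := (p.1, val (if p.1 then d2 else d1) p.2).
Let be (p : dart) : dart :=
  if p.1 == p.2.1 then p else (~~ p.1, (~~ p.2.1, p.2.2)).
Let pi (p : dart) : W := (inord (p.1 + p.2.1), p.2.2).
Notation E := (comp_edge d1 d2).

Lemma col_pi p : col_ (pi p) = p.1 + p.2.1.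
Proof. by rewrite /col_ /= inordK //; case: p => [[] [[]]]. Qed.

Lemma alK : involutive al.
Proof. by case=> b u; rewrite /al /= diagK. Qed.

Lemma beK : involutive be.
Proof. by case=> [[] [[] i]]. Qed.

Lemma pi_be p : pi (be p) = pi p.
Proof. by case: p => [[] [[] i]]. Qed.

Lemma pi_eq p q : pi p = pi q -> q = p \/ q = be p.
Proof.
move=> e; have := congr1 (@col_ r s) e; rewrite !col_pi; case: e => _.
by case: p q => [[] [[] i]] [[] [[] j]] //= ->; auto.
Qed.

Lemma outer_pi u : outer u = pi (u.1, u).
Proof. by rewrite /outer /pi /=; case: u.1. Qed.

Lemma W_eq (x y : W) : col_ x = col_ y -> x.2 = y.2 -> x = y.
Proof. by case: x y => [x i] [y j] /= exy ->; congr pair; apply: val_inj. Qed.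

Lemma col_lt3 (x : W) : col_ x < 3.
Proof. exact: ltn_ord. Qed.

Lemma as1_pi u : as1 (pi (false, u)) = u.
Proof. by rewrite /as1 col_pi /=; case: u => [[] i]. Qed.

Lemma as2_pi u : as2 (pi (true, u)) = u.
Proof. by rewrite /as2 col_pi /=; case: u => [[] i]. Qed.

Lemma comp_edgeP (x y : W) : reflect (exists2 p, pi p = x & pi (al p) = y) (E x y).
Proof.
apply: (iffP orP) => [[]/and3P[cx cy /eqP e]|[[[] u] <- <-]].
- exists (false, as1 x); first by apply: W_eq; rewrite ?col_pi //=; case: col_ cx => [|[]].
  rewrite /al /= e; apply: W_eq; rewrite ?col_pi //=; by case: col_ cy => [|[]].
- have := col_lt3 x; have := col_lt3 y => cx3 cy3.
  exists (true, as2 x); first by apply: W_eq; rewrite ?col_pi //=; case: col_ cx cy3 => [|[|[]]].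
  rewrite /al /= e; apply: W_eq; rewrite ?col_pi //=; by case: col_ cy cx3 => [|[|[]]].
- by right; rewrite !as2_pi !col_pi eqxx.
- by left; rewrite !as1_pi !col_pi !leq_b1 eqxx.
Qed.

Lemma comp_edge_sym : symmetric E.
Proof.
move=> x y; apply/comp_edgeP/comp_edgeP => -[p <- <-]; exists (al p); rewrite ?alK //.
Qed.

Lemma connectE_sym : connect_sym E.
Proof. exact/sym_connect_sym/comp_edge_sym. Qed.

(** The darts fixed by [be] are the outer vertices, so the walk from [u] ends at the only other
    outer vertex of its component. The sign makes the composite a walled diagram. *)
Lemma outer_partner u : exists2 v, wsign v = ~~ wsign u &
  forall v', ((u != v') && connect E (outer u) (outer v')) = (v' == v).
Proof.
pose sg (p : dart) := wsign p.2.
have sg_al p : sg (al p) = ~~ sg p by rewrite /sg wsign_diag.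
have sg_be p : be p != p -> sg (be p) = ~~ sg p.
  case: p => [b [c i]]; rewrite /be /sg /=; case: (b =P c) => _; first by rewrite eqxx.
  by rewrite /wsign /= addNb.
have beu : be (u.1, u) = (u.1, u) by rewrite /be /= eqxx.
have [[b v] [bev sv reach [P [Pu Pal Pbe Pfix]]]] := walk_end alK beK sg_al sg_be beu.
have bE : b = v.1.
  by move: bev; rewrite /be /=; case: eqP => // _ [] /(congr1 negb); rewrite negbK; case: (b).
subst b; exists v => // v'.
have uv : u != v by apply/eqP => e; move: sv; rewrite /sg /= e; case: wsign.
apply/andP/eqP => [[uv' con]|->]; last first.
  split=> //; rewrite (outer_pi v).
  apply: (reach (fun p => connect E (outer u) (pi p))) => [|p cp|p cp]; last by rewrite pi_be.
    by rewrite outer_pi.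
  by apply: connect_trans cp (connect1 _); apply/comp_edgeP; exists p.
have [q piq Pq] : exists2 q, pi q = outer v' & P q.
  case/connectP: con => c cP ->.
  have [q e Pq] : exists2 q, pi q = outer u & P q by exists (u.1, u); rewrite ?outer_pi.
  elim: c (outer u) q e Pq cP => [|y c IH] x q e Pq /=; first by exists q.
  case/andP => /comp_edgeP[p ep <-]; apply: (IH _ (al p)) => //; apply: Pal.
  by have [->|->] := pi_eq (etrans e (esym ep)); rewrite ?Pbe.
have bev' : be (v'.1, v') = (v'.1, v') by rewrite /be /= eqxx.
have Pv' : P (v'.1, v').
  by have [->|->] := pi_eq (etrans piq (outer_pi v')); rewrite ?Pbe.
by case: (Pfix _ Pv' bev') => -[_] // e; rewrite e eqxx in uv'.
Qed.

Definition is_comp d3 := [forall u : V, forall v : V,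
  (val d3 u == v) == ((u != v) && connect E (outer u) (outer v))].

Lemma is_compP d3 : reflect
  (forall u v, (val d3 u == v) = ((u != v) && connect E (outer u) (outer v))) (is_comp d3).
Proof.
apply: (iffP forallP) => [h u v|h u]; first by have /forallP/(_ v)/eqP := h u.
by apply/forallP => v; rewrite h.
Qed.

Lemma dcomp_ex : exists d3, is_comp d3.
Proof.
have /fin_all_exists2[p ps pE] := outer_partner.
have wbp : is_wb (finfun p).
  apply/is_wbP => u; rewrite !ffunE ps; split=> //; apply/esym/eqP.
  by rewrite -pE eq_sym connectE_sym pE.
exists (Sub _ wbp); apply/is_compP => u v; rewrite pE SubK ffunE.
exact: eq_sym.
Qed.

Definition dcomp := xchoose dcomp_ex.

Lemma dcompE u v : (val dcomp u == v) = ((u != v) && connect E (outer u) (outer v)).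
Proof. by have /is_compP -> := xchooseP dcomp_ex. Qed.

Lemma is_compE d3 : is_comp d3 = (d3 == dcomp).
Proof.
apply/is_compP/eqP => [h|->]; last exact: dcompE.
by apply/val_inj/ffunP => u; apply/esym/eqP; rewrite dcompE -h.
Qed.

Definition wcolour f g h (x : W) : bool :=
  if col_ x == 0 then f x.2 else if col_ x == 1 then g x.2 else h x.2.

Lemma wcolour_pi f g h p :
  wcolour f g h (pi p) = if p.1 then colour g h p.2 else colour f g p.2.
Proof. by rewrite /wcolour col_pi; case: p => [[] [[] i]]. Qed.

Lemma wcolour_outer f g h u : wcolour f g h (outer u) = colour f h u.
Proof. by rewrite outer_pi wcolour_pi /=; case: u => [[] i]. Qed.

Lemma compat_edgeP f g h :
  reflect (forall x y, connect E x y -> wcolour f g h x = wcolour f g h y)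
          (compat d1 f g && compat d2 g h).
Proof.
apply: (iffP andP) => [[/compatP c1 /compatP c2] x y|c]; last first.
  split; apply/compatP => u; apply/esym.
    have := c (pi (false, u)) (pi (al (false, u))); rewrite !wcolour_pi; apply.
    by apply/connect1/comp_edgeP; exists (false, u).
  have := c (pi (true, u)) (pi (al (true, u))); rewrite !wcolour_pi; apply.
  by apply/connect1/comp_edgeP; exists (true, u).
apply: (@closed_connect _ E [pred x | wcolour f g h x]) => {}x {}y.
move=> /comp_edgeP[p <- <-]; rewrite !inE !wcolour_pi /=.
by case: p => [[] u] /=; rewrite (c1, c2).
Qed.

Lemma outer_of (x : W) : col_ x != 1 -> exists u, x = outer u.
Proof.
move=> x1; exists (col_ x == 2, x.2); apply: W_eq => //.
rewrite outer_pi col_pi /=; have := col_lt3 x.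
by case: (col_ x) x1 => [|[|[]]].
Qed.

Section Count.
Variables f h : {ffun 'I_N -> bool}.

Lemma compat_comp g : compat d1 f g -> compat d2 g h -> compat dcomp f h.
Proof.
move=> c1 c2; have /compat_edgeP c : compat d1 f g && compat d2 g h by rewrite c1 c2.
apply/compatP => u; rewrite -!(wcolour_outer f g h); apply/esym/c.
by have := dcompE u (val dcomp u); rewrite eqxx => /esym/andP[].
Qed.

Hypothesis cfh : compat dcomp f h.

Let loops := [set x : W | [&& col_ x == 1,
        [forall y, connect E x y ==> (col_ y == 1)] & fingraph.root E x == x]].

(** Components that reach an outer column inherit its colour; a closed loop is coloured true when
    its root lies in [S]. *)
Let extend (S : {set W}) (x : W) : bool :=
  if [pick u | connect E x (outer u)] is Some u then colour f h u
  else fingraph.root E x \in S.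

Let fill S : {ffun 'I_N -> bool} := [ffun i => extend S (inord 1, i)].

Lemma colour_connect u v : connect E (outer u) (outer v) -> colour f h u = colour f h v.
Proof.
move=> c; have [->//|uv] := eqVneq u v.
have /eqP <- : val dcomp u == v by rewrite dcompE uv c.
by rewrite (compatP _ _ _ cfh).
Qed.

Lemma extend_connect S x y : connect E x y -> extend S x = extend S y.
Proof.
move=> cxy; rewrite /extend; case: pickP => [u xu|nx]; case: pickP => [v yv|ny].
- apply: colour_connect; apply: connect_trans yv; apply: connect_trans cxy.
  by rewrite connectE_sym.
- by have := ny u; rewrite (connect_trans _ xu) // connectE_sym.
- by have := nx v; rewrite (connect_trans cxy yv).
by rewrite (fingraph.rootP connectE_sym cxy).
Qed.

Lemma extend_outer S u : extend S (outer u) = colour f h u.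
Proof.
rewrite /extend; case: pickP => [v|/(_ u)]; last by rewrite connect0.
by move/colour_connect.
Qed.

Lemma wcolour_fill S x : wcolour f (fill S) h x = extend S x.
Proof.
have [x1|/outer_of[u ->]] := eqVneq (col_ x) 1; last by rewrite wcolour_outer extend_outer.
rewrite /wcolour x1 /= ffunE; congr extend; apply: W_eq => //=.
by rewrite /col_ /= inordK.
Qed.

Lemma fill_ok S : compat d1 f (fill S) && compat d2 (fill S) h.
Proof. by apply/compat_edgeP => x y c; rewrite !wcolour_fill; apply: extend_connect. Qed.

Lemma mem_fill S x : x \in loops -> fill S x.2 = (x \in S).
Proof.
rewrite inE => /and3P[/eqP x1 /forallP nx /eqP rx].
have -> : fill S x.2 = wcolour f (fill S) h x by rewrite /wcolour x1.
rewrite wcolour_fill /extend; case: pickP => [u xu|_]; last by rewrite rx.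
by have := nx (outer u); rewrite xu outer_pi col_pi /=; case: u.1.
Qed.

Lemma fill_onto g : compat d1 f g && compat d2 g h ->
  g = fill [set x in loops | g x.2].
Proof.
move=> /compat_edgeP c; apply/ffunP => i; rewrite ffunE /extend.
have gi : g i = wcolour f g h (inord 1, i) by rewrite /wcolour /col_ /= inordK.
case: pickP => [u iu|ni]; first by rewrite gi (c _ _ iu) wcolour_outer.
set x := fingraph.root _ _; have ix : connect E (inord 1, i) x by apply: connect_root.
have mid y : connect E (inord 1, i) y -> col_ y == 1.
  by apply: contraTT => /outer_of[u ->]; rewrite ni.
rewrite !inE (mid _ ix) (fingraph.root_root connectE_sym) eqxx andbT /=.
rewrite (_ : [forall y, _] = true); last first.
  by apply/forallP => y; apply/implyP => xy; apply/mid/(connect_trans ix xy).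
by rewrite gi (c _ _ ix) /wcolour (eqP (mid _ ix)).
Qed.

(** [fill] is a bijection from the sets of loops onto the admissible colourings of the middle
    column. *)
Lemma card_middle : #|[pred g | compat d1 f g && compat d2 g h]| = 2 ^ nloops d1 d2.
Proof.
have -> : nloops d1 d2 = #|loops| by rewrite cardsE.
rewrite -card_powerset -(card_in_imset (f := fill)) => [|S S']; last first.
  rewrite !inE => /subsetP SL /subsetP SL' /ffunP e; apply/setP => x.
  have [xL|nx] := boolP (x \in loops); first by rewrite -(mem_fill S xL) -(mem_fill S' xL) e.
  by apply/idP/idP => /[dup] hx; [move/SL|move/SL']; rewrite (negbTE nx).
apply: eq_card => g; rewrite inE; apply/idP/imsetP => [ok|[S _ ->]]; last exact: fill_ok.
exists [set x in loops | g x.2]; last exact: fill_onto.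
by rewrite inE; apply/subsetP => x; rewrite inE => /andP[].
Qed.

End Count.

Lemma sum_compat f h :
  \sum_g compat d1 f g * compat d2 g h = 2 ^ nloops d1 d2 * compat dcomp f h.
Proof.
have [c|nc] := boolP (compat dcomp f h).
  rewrite muln1 -(card_middle c) -sum1_card [RHS]big_mkcond.
  by apply: eq_bigr => g _; rewrite inE mulnb; case: (_ && _).
rewrite muln0 big1 // => g _; rewrite mulnb.
by case: andP nc => // -[c1 c2]; rewrite (compat_comp c1 c2).
Qed.

End Composite.
End Diagrams.

(** * Associativity, levels and caps of diagrams *)

Section Monoid.
Variables r s : nat.
Notation N := (Nv r s).
Notation V := (vert r s).
Notation diag := (wbdiag r s).
Implicit Types (a b c d x y : diag) (f g h : {ffun 'I_N -> bool}).

(** Without multiplicities, composition of diagrams becomes composition of relations between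
    colourings. *)
Lemma compat_dcompP a b f h :
  reflect (exists2 g, compat a f g & compat b g h) (compat (dcomp a b) f h).
Proof.
apply: (iffP idP) => [cfh|[g]]; last exact: compat_comp.
have : 0 < #|[pred g | compat a f g && compat b g h]|.
  by rewrite card_middle // expn_gt0.
by case/card_gt0P => g /andP[]; exists g.
Qed.

Lemma dcompA : associative (@dcomp r s).
Proof.
move=> a b c; apply: compat_inj => f h.
apply/compat_dcompP/compat_dcompP => [[g ag /compat_dcompP[g' bg cg]]|[g /compat_dcompP[g' ag bg] cg]].
  by exists g' => //; apply/compat_dcompP; exists g.
by exists g' => //; apply/compat_dcompP; exists g.
Qed.

Lemma nloopsA a b c :
  nloops a b + nloops (dcomp a b) c = nloops b c + nloops a (dcomp b c).
Proof.
(* A constant colouring is compatible with every diagram, so in this entry of the triple matrix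
   product only the powers of 2 remain. *)
pose f : {ffun 'I_N -> bool} := [ffun=> true].
have cf d : compat d f f by apply/compatP => u; rewrite /colour !ffunE !if_same.
apply: (@expnI 2) => //; rewrite !expnD.
have E1 : \sum_h (\sum_g compat a f g * compat b g h) * compat c h f =
          2 ^ nloops a b * 2 ^ nloops (dcomp a b) c.
  under eq_bigr do rewrite sum_compat -mulnA.
  by rewrite -big_distrr /= sum_compat cf muln1.
have E2 : \sum_g compat a f g * (\sum_h compat b g h * compat c h f) =
          2 ^ nloops b c * 2 ^ nloops a (dcomp b c).
  under eq_bigr do rewrite sum_compat mulnCA.
  by rewrite -big_distrr /= sum_compat cf muln1.
rewrite -E1 -E2; under eq_bigr do rewrite big_distrl.
rewrite exchange_big /=; apply: eq_bigr => g _; rewrite big_distrr /=.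
by apply: eq_bigr => h _; rewrite mulnA.
Qed.

Definition lev d := #|[pred i | ~~ (val d (false, i)).1]|.

(** Propagating edges match the remaining vertices of the two columns, which have equal size. *)
Lemma lev_right d : lev d = #|[pred i | (val d (true, i)).1]|.
Proof.
have e : #|[pred i | (val d (false, i)).1]| = #|[pred i | ~~ (val d (true, i)).1]|.
  pose m (c : bool) i := (val d (c, i)).2.
  have mK (c : bool) i : (val d (c, i)).1 = ~~ c -> m (~~ c) (m c i) = i.
    by rewrite /m => e; rewrite -e -surjective_pairing diagK.
  rewrite -(card_in_image (f := m false)) => [|i j]; last first.
    by rewrite !inE => di dj e; rewrite -(mK false i di) -(mK false j dj) e.
  apply: eq_card => j; rewrite inE; apply/imageP/idP => [[i di ->]|dj].
    rewrite inE in di; rewrite /m -di -surjective_pairing diagK /=; by [].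
  exists (m true j); last by rewrite (mK true) //; apply/negbTE.
  by rewrite inE /m -(negbTE dj) -surjective_pairing diagK.
apply: (@addnI #|[pred i | (val d (false, i)).1]|).
rewrite {2}e [RHS]addnC; transitivity #|'I_N|; [|apply/esym].
  exact: (cardC [pred i | (val d (false, i)).1]).
exact: (cardC [pred i | (val d (true, i)).1]).
Qed.

Lemma dcomp_left a b i j :
  val a (false, i) = (false, j) -> val (dcomp a b) (false, i) = (false, j).
Proof.
move=> aij; apply: diag_colour; first by rewrite -aij eq_sym diag_neq.
move=> f h /compat_dcompP[g /compatP/(_ (false, i))]; rewrite aij /colour /=.
by move=> ->.
Qed.

Lemma dcomp_right a b i j :
  val b (true, i) = (true, j) -> val (dcomp a b) (true, i) = (true, j).
Proof.
move=> bij; apply: diag_colour; first by rewrite -bij eq_sym diag_neq.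
move=> f h /compat_dcompP[g _ /compatP/(_ (true, i))]; rewrite bij /colour /=.
by move=> ->.
Qed.

Lemma left_sub a b :
  [pred i | ~~ (val a (false, i)).1] \subset [pred i | ~~ (val (dcomp a b) (false, i)).1].
Proof.
apply/subsetP => i; rewrite !inE.
by case e: (val a (false, i)) => [[] j] // _; rewrite (dcomp_left b e).
Qed.

Lemma lev_mull a b : lev a <= lev (dcomp a b).
Proof. exact/subset_leq_card/left_sub. Qed.

Lemma lev_mulr a b : lev b <= lev (dcomp a b).
Proof.
rewrite !lev_right; apply/subset_leq_card/subsetP => i; rewrite !inE.
by case e: (val b (true, i)) => [[] j] // _; rewrite (dcomp_right a e).
Qed.

(* The underlying diagram of the e_x of the header. *)
Definition cap_fun x (u : V) : V :=
  let v := val x (false, u.2) in if v.1 then (~~ u.1, u.2) else (u.1, v.2).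

Lemma cap_funP x : is_wb (finfun (cap_fun x)).
Proof.
apply/is_wbP => -[b i]; rewrite !ffunE /cap_fun /=.
case e: (val x (false, i)) => [[] j] /=; first by rewrite e negbK /wsign /= addNb.
have := diagK x (false, i); rewrite e => ->; split=> //.
have := wsign_diag x (false, i); rewrite e /wsign /=; case: b => //=.
by move=> ->; rewrite negbK.
Qed.

Definition cap x : diag := Sub _ (cap_funP x).

Lemma capE x u : val (cap x) u = cap_fun x u.
Proof. by rewrite SubK ffunE. Qed.

Lemma lev_cap x : lev (cap x) = lev x.
Proof.
apply: eq_card => i; rewrite !inE capE /cap_fun /=.
by case: (val x (false, i)) => [[] j].
Qed.

(** A middle colouring compatible with [cap x] agrees with [f] on the propagating rows, and [f] is
    constant on the left edges of [x]; conversely [f] itself serves as middle colouring. *)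
Lemma cap_mul x : dcomp (cap x) x = x.
Proof.
apply: compat_inj => f h; apply/compat_dcompP/idP => [[g /compatP cg /compatP xg]|xf].
  have fg i j : val x (false, i) = (true, j) -> f i = g i.
    by move=> e; have := cg (false, i); rewrite capE /cap_fun /= e /colour /=.
  apply/compatP => -[b i]; have := xg (b, i).
  case: b; case e: (val x _) => [[] j]; rewrite /colour //=.
  - by rewrite (fg j i) // -e diagK.
  - by rewrite (fg i j).
  - by move=> _; have := cg (false, i); rewrite capE /cap_fun /= e /colour.
exists f => //; apply/compatP => -[b i]; rewrite capE /cap_fun /=.
have := compatP _ _ _ xf (false, i).
by case: (val x (false, i)) => [[] j] /=; rewrite /colour /= ?if_same; case: b.
Qed.

(** The left edges of [x] persist in the product, and equal level leaves no room for others. *)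
Lemma cap_dcomp x y : lev (dcomp x y) = lev x -> cap (dcomp x y) = cap x.
Proof.
move=> e; have /subset_cardP := esym e; move/(_ (left_sub x y)) => eL.
apply/val_inj/ffunP => u; rewrite !capE /cap_fun.
have := eL u.2; rewrite !inE => /negb_inj <-.
case: ifP => // xL; case e1: (val x (false, u.2)) xL => [[] j] // _.
by rewrite (dcomp_left y e1).
Qed.

(** Compare the loops of the two bracketings of [cap x], [x], [y]. *)
Lemma nloops_cap_dcomp x y : lev (dcomp x y) = lev x ->
  nloops (cap (dcomp x y)) (dcomp x y) = nloops (cap x) x.
Proof.
move=> e; rewrite cap_dcomp //; apply: (@addnI (nloops x y)).
by rewrite -nloopsA cap_mul addnC.
Qed.

End Monoid.

(** * Permutation diagrams *)

Section Permutations.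
Variables r s : nat.
Notation N := (Nv r s).
Notation V := (vert r s).
Notation diag := (wbdiag r s).
Implicit Types (d : diag) (g h : symprod r s).

Definition gfun g (i : 'I_N) : 'I_N :=
  match fintype.split i with inl j => lshift s (g.1 j) | inr j => rshift r (g.2 j) end.

Lemma gfun_lt g i : (gfun g i < r) = (i < r).
Proof.
rewrite /gfun; case: (fintype.split_ordP i) => j _; first by rewrite /= ltn_ord.
by rewrite /= ltnNge leq_addr.
Qed.

Definition ginv g : symprod r s := (g.1^-1, g.2^-1)%g.

Lemma gfun_lshift g j : gfun g (lshift s j) = lshift s (g.1 j).
Proof.
rewrite /gfun; case: (fintype.split_ordP (lshift s j)) => j' /eqP.
  by rewrite eq_lshift => /eqP ->.
by rewrite eq_lrshift.
Qed.

Lemma gfun_rshift g j : gfun g (rshift r j) = rshift r (g.2 j).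
Proof.
rewrite /gfun; case: (fintype.split_ordP (rshift r j)) => j' /eqP.
  by rewrite eq_rlshift.
by rewrite eq_rshift => /eqP ->.
Qed.

Lemma gfunK g : cancel (gfun g) (gfun (ginv g)).
Proof.
move=> i; case: (fintype.split_ordP i) => j ->.
  by rewrite !gfun_lshift permK.
by rewrite !gfun_rshift permK.
Qed.

Lemma ginvK : involutive ginv.
Proof. by case=> g h; rewrite /ginv /= !invgK. Qed.

Lemma gfunVK g : cancel (gfun (ginv g)) (gfun g).
Proof. by have := gfunK (ginv g); rewrite ginvK. Qed.

Definition pd_fun g (u : V) : V := (~~ u.1, gfun (if u.1 then ginv g else g) u.2).

Lemma pd_funP g : is_wb (finfun (pd_fun g)).
Proof.
apply/is_wbP => -[b i]; rewrite !ffunE /pd_fun /= negbK; split.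
  by case: b => /=; rewrite ?gfunK ?gfunVK.
by rewrite /wsign /= gfun_lt addNb.
Qed.

Definition pdiag g : diag := Sub _ (pd_funP g).

Lemma pdiagE g u : val (pdiag g) u = pd_fun g u.
Proof. by rewrite SubK ffunE. Qed.

Lemma compat_pdiagP g (f f' : {ffun 'I_N -> bool}) :
  reflect (forall i, f' (gfun g i) = f i) (compat (pdiag g) f f').
Proof.
apply: (iffP (compatP _ _ _)) => [c i|c [[] i]]; rewrite ?pdiagE.
- by have := c (false, i); rewrite pdiagE.
- by rewrite /colour /= -c gfunVK.
- by rewrite /colour /= c.
Qed.

Lemma lev_pdiag g : lev (pdiag g) = 0.
Proof. by apply: eq_card0 => i; rewrite !inE pdiagE. Qed.

Lemma pdiag_inj : injective pdiag.
Proof.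
move=> g h e; have {}e i : gfun g i = gfun h i.
  by have := congr1 (fun d => (val d (false, i)).2) e; rewrite /= !pdiagE.
case: g h e => [g1 g2] [h1 h2] e; congr pair; apply/permP => j.
  by have := e (lshift s j); rewrite !gfun_lshift => /lshift_inj.
by have := e (rshift r j); rewrite !gfun_rshift => /rshift_inj.
Qed.

Lemma gfunM g h i : gfun ((g.1 * h.1)%g, (g.2 * h.2)%g) i = gfun h (gfun g i).
Proof.
case: (fintype.split_ordP i) => j ->.
  by rewrite !gfun_lshift permM.
by rewrite !gfun_rshift permM.
Qed.

(** Permutations multiply from left to right, as diagrams do, so no inverse enters. *)
Lemma pdiagM g h : dcomp (pdiag g) (pdiag h) = pdiag ((g.1 * h.1)%g, (g.2 * h.2)%g).
Proof.
apply: compat_inj => f f'; apply/compat_dcompP/compat_pdiagP => [[f1]|c].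
  by move=> /compat_pdiagP c1 /compat_pdiagP c2 i; rewrite gfunM c2 c1.
exists [ffun i => f' (gfun h i)]; apply/compat_pdiagP => i; rewrite ?ffunE //.
by rewrite -gfunM.
Qed.

(** The left colouring determines the middle one, so [2 ^ nloops] is at most 1. *)
Lemma nloops_pdiag g h : nloops (pdiag g) (pdiag h) = 0.
Proof.
pose f : {ffun 'I_N -> bool} := [ffun=> true].
have cf d : compat d f f by apply/compatP => u; rewrite /colour !ffunE !if_same.
apply/eqP; rewrite -leqn0 -(@leq_exp2l 2) // expn0 -(card_middle (cf _)).
apply/card_le1P => f1; rewrite inE => /andP[/compat_pdiagP c1 _] f2.
rewrite !inE; apply/andP/eqP => [[/compat_pdiagP c2 _]|->]; last first.
  split; first exact/compat_pdiagP.
  apply/compat_pdiagP => i; rewrite -[i in RHS](gfunVK g) c1.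
  by rewrite !ffunE.
by apply/ffunP => i; rewrite -[i](gfunVK g) c1 c2.
Qed.

Lemma lev0_pdiag d : lev d = 0 -> exists g, d = pdiag g.
Proof.
move=> /card0_eq d0; pose p i := (val d (false, i)).2.
have dp i : val d (false, i) = (true, p i).
  rewrite [LHS]surjective_pairing; congr pair.
  by have := d0 i; rewrite !inE => /negbFE.
have p_inj : injective p.
  move=> i j e; have := congr1 (val d) (dp i).
  by rewrite e -dp !diagK => -[].
(* Propagating edges respect the wall, so [p] splits into a permutation of each block. *)
have p_lt i : (p i < r) = (i < r).
  have := wsign_diag d (false, i); rewrite dp /wsign /=.
  by case: (p i < r); case: (i < r).
have lt1 (j : 'I_r) : p (lshift s j) < r by rewrite p_lt /=.
have ge2 (j : 'I_s) : r <= p (rshift r j) by rewrite leqNgt p_lt /= -leqNgt leq_addr.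
have lt2 (j : 'I_s) : p (rshift r j) - r < s.
  by rewrite ltn_subLR //; apply: ltn_ord.
have inj1 : injective (fun j => Ordinal (lt1 j)).
  by move=> i j /(congr1 val) /= /val_inj /p_inj /lshift_inj.
have inj2 : injective (fun j => Ordinal (lt2 j)).
  move=> i j /(congr1 val) /= e; apply: (@rshift_inj r); apply/p_inj/val_inj.
  by rewrite /= -(subnKC (ge2 i)) e subnKC.
pose g : symprod r s := (perm inj1, perm inj2).
have pE i : p i = gfun g i.
  case: (fintype.split_ordP i) => j ->; rewrite ?gfun_lshift ?gfun_rshift permE.
    exact: val_inj.
  by apply: val_inj; rewrite /= subnKC.
exists g; apply/val_inj/ffunP => -[[] i]; rewrite pdiagE /pd_fun /=; last by rewrite dp pE.
apply: (can_inj (diagK d)); rewrite diagK dp pE.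
by rewrite gfunVK.
Qed.

End Permutations.

(** * The product and augmentation of the walled Brauer algebra *)

Section WalledBrauerAlgebra.
Local Open Scope ring_scope.
Variables (k : comPzRingType) (r s : nat) (delta : k).
Notation diag := (wbdiag r s).
Implicit Types x y : diag.

Lemma wb_multE x y (d : diag) :
  wb_mult delta x y d = if d == dcomp x y then delta ^+ nloops x y else 0.
Proof. by rewrite /wb_mult -/(is_comp x y d) is_compE. Qed.

Lemma wb_epsE x : wb_eps k x = (lev x == 0%N)%:R.
Proof.
rewrite /wb_eps; case: forallP => h.
  by rewrite /lev eq_card0 // => i; rewrite !inE h.
case: eqP => // /card0_eq h'; case: h => i.
by have := h' i; rewrite !inE => /negbFE.
Qed.

(** A factor of positive level makes both sides zero; two permutation diagrams form no loop. *)
Lemma wb_epsM x y : wb_eps k x * wb_eps k y = delta ^+ nloops x y * wb_eps k (dcomp x y).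
Proof.
rewrite !wb_epsE; have [/lev0_pdiag[g ->]|x0] := eqVneq (lev x) 0%N; last first.
  rewrite (_ : lev (dcomp x y) == 0%N = false) ?mul0r ?mulr0 //.
  by apply: contraNF x0 => /eqP e; rewrite -leqn0 -e lev_mull.
have [/lev0_pdiag[h ->]|y0] := eqVneq (lev y) 0%N; last first.
  rewrite (_ : lev (dcomp _ y) == 0%N = false) ?mulr0 //.
  by apply: contraNF y0 => /eqP e; rewrite -leqn0 -e lev_mulr.
by rewrite nloops_pdiag pdiagM lev_pdiag.
Qed.

End WalledBrauerAlgebra.

Local Open Scope ring_scope.

Theorem theorem8p1 (k : comPzRingType) (r s : nat) (delta : k)
  (hdelta : exists delta' : k, delta * delta' = 1) :
  (forall n : nat,
     Tor_iso (@wb_mult r s k delta) (@wb_eps r s k)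
             (@grp_mult k r s) (@grp_eps k r s) n) /\
  (forall n : nat,
     Ext_iso (@wb_mult r s k delta) (@wb_eps r s k)
             (@grp_mult k r s) (@grp_eps k r s) n).
Proof.
have [delta' dd'] := hdelta.
pose w (x y : wbdiag r s) : k := delta ^+ nloops x y.
pose eta (x : wbdiag r s) : k := delta' ^+ nloops (cap x) x.
have wA x y z : w x y * w (dcomp x y) z = w y z * w x (dcomp y z).
  by rewrite /w -!exprD nloopsA.
have eps_lev (x : wbdiag r s) : (0 < lev x)%N -> wb_eps k x = 0.
  by rewrite wb_epsE lt0n => /negbTE ->.
have eta_w (x : wbdiag r s) : (0 < lev x)%N -> eta x * w (cap x) x = 1.
  by move=> _; rewrite /eta /w -exprMn mulrC dd' expr1n.
have eta_mul (x y : wbdiag r s) : (0 < lev x)%N -> lev (dcomp x y) = lev x ->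
    eta (dcomp x y) = eta x.
  by move=> _ e; rewrite /eta nloops_cap_dcomp.
have io_w (g h : symprod r s) : w (pdiag g) (pdiag h) = 1 by rewrite /w nloops_pdiag.
have io_eps (g : symprod r s) : wb_eps k (pdiag g) = grp_eps k g.
  by rewrite wb_epsE lev_pdiag eqxx.
(* [g1] and its diagram serve only as default entries when lists are read. *)
have g1 : symprod r s := (1%g, 1%g).
pose gm (g h : symprod r s) : symprod r s := ((g.1 * h.1)%g, (g.2 * h.2)%g).
have gmE (x y z : symprod r s) : grp_mult k x y z = if z == gm x y then 1 else 0 by [].
split=> n.
  exact: (@Tor_iso_low k _ _ (pdiag g1) g1 (@pdiag r s) (@dcomp r s) w _ _ gm (fun _ _ => 1) _ _
    (wb_multE delta) gmE (@dcompA r s) wA (wb_epsM delta)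
    (@lev r s) (@cap r s) eta (@lev_mull r s) (@lev_mulr r s) eps_lev (@lev_cap r s)
    (fun x _ => cap_mul x) eta_w (@cap_dcomp r s) eta_mul (@pdiagM r s) io_w io_eps
    (@pdiag_inj r s) (@lev_pdiag r s) (@lev0_pdiag r s)).
exact: (@Ext_iso_low k _ _ (pdiag g1) g1 (@pdiag r s) (@dcomp r s) w _ _ gm (fun _ _ => 1) _ _
    (wb_multE delta) gmE (@dcompA r s) wA (wb_epsM delta)
    (@lev r s) (@cap r s) eta (@lev_mull r s) (@lev_mulr r s) eps_lev (@lev_cap r s)
    (fun x _ => cap_mul x) eta_w (@cap_dcomp r s) eta_mul (@pdiagM r s) io_w io_eps
    (@pdiag_inj r s) (@lev_pdiag r s) (@lev0_pdiag r s)).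
Qed.
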